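(* Let $1\le N\le n$ be integers and let $r_1,\ldots,r_N\ge 0$ be prescribed real numbers. Among all $N$-tuples of vectors $v_1,\ldots,v_N\in\mathbb R^n$ with $|v_i|=r_i$ for all $i=1,\ldots,N$, the value $P(v_1,-v_1,\ldots,v_N,-v_N)$ is maximized when all the vectors $v_i$ are orthogonal to each other. That is, if $|v_i|=|w_i|=r_i$ for all $i$ and $w_i\cdot w_j=0$ for all $i\neq j$, then $$P(v_1,-v_1,\ldots,v_N,-v_N)\le P(w_1,-w_1,\ldots,w_N,-w_N).$$
   Context: For vectors $u_1,\ldots,u_M\in\mathbb R^n$ put $$P(u_1,\ldots,u_M)=\int_{\mathbb R^n}\max_{1\le i\le M} e^{-|x-u_i|^2}\,dx,$$ where $|\cdot|$ is the Euclidean norm. *)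

(* Defs.v *)
From HB Require Import structures.
From mathcomp Require Import all_boot all_order all_algebra.
From mathcomp Require Import all_classical all_reals all_analysis.

Set Implicit Arguments.
Unset Strict Implicit.
Unset Printing Implicit Defensive.
Import Order.TTheory GRing.Theory Num.Theory.
Import numFieldNormedType.Exports.

Local Open Scope classical_set_scope.
Local Open Scope ring_scope.

(* 'rV[R]_n carries the sigma-algebra generated by the coordinates, i.e. the
   Borel sigma-algebra of R^n; this mirrors the library's instance on
   n.-tuple T. *)
Definition measure_rV_display : measure_display -> measure_display.
Proof. exact. Qed.

Section measurable_rV.
Context {R : realType}.
Variable n : nat.

Definition coord_rV (i : 'I_n) (x : 'rV[R]_n) : R := x ord0 i.

Let rV_set0 : g_sigma_preimage coord_rV set0.
Proof. exact: sigma_algebra0. Qed.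

Let rV_setC A : g_sigma_preimage coord_rV A -> g_sigma_preimage coord_rV (~` A).
Proof. exact: sigma_algebraC. Qed.

Let rV_bigcup (F : (set 'rV[R]_n)^nat) :
  (forall i, g_sigma_preimage coord_rV (F i)) ->
  g_sigma_preimage coord_rV (\bigcup_i (F i)).
Proof. exact: sigma_algebra_bigcup. Qed.

HB.instance Definition _ := @isMeasurable.Build
  (measure_rV_display default_measure_display) 'rV[R]_n
  (g_sigma_preimage coord_rV) rV_set0 rV_setC rV_bigcup.

Lemma measurable_coord_rV (i : 'I_n) : measurable_fun setT (coord_rV i).
Proof.
move=> _ Y mY; rewrite setTI; apply: sub_sigma_algebra => /=.
rewrite -bigcup_seq/=; exists i => /=; first by rewrite mem_index_enum.
by exists Y => //; rewrite setTI.
Qed.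

Lemma measurable_fun_rV d (T : measurableType d) (f : T -> 'rV[R]_n) :
  (forall i, measurable_fun setT (coord_rV i \o f)) -> measurable_fun setT f.
Proof.
move=> mf _ Y mY; rewrite setTI.
suff /(_ Y mY) : g_sigma_preimage coord_rV `<=` [set A | measurable (f @^-1` A)].
  by [].
apply: smallest_sub.
  split=> [|A /= mA|F /= mF].
  - by rewrite /= preimage_set0.
  - by rewrite setTD -preimage_setC; exact: measurableC.
  - by rewrite preimage_bigcup; exact: bigcupT_measurable.
rewrite -bigcup_seq/= => A [i _] [B mB <-] /=.
by have := mf i measurableT B mB; rewrite !setTI.
Qed.

End measurable_rV.

Section lebesgue_rV.
Context {R : realType}.
Local Open Scope ereal_scope.

Definition cons_rV n (p : measurableTypeR R * 'rV[R]_n) : 'rV[R]_n.+1 :=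
  row_mx (const_mx p.1 : 'rV[R]_1) p.2.

Definition uncons_rV n (x : 'rV[R]_n.+1) : measurableTypeR R * 'rV[R]_n :=
  (x ord0 ord0, rsubmx (x : 'rV[R]_(1 + n))).

Lemma cons_rVK n : cancel (@cons_rV n) (@uncons_rV n).
Proof.
move=> [a y]; rewrite /uncons_rV /cons_rV/= row_mxKr; congr pair.
have -> : @ord0 n = lshift n (ord0 : 'I_1) by apply/val_inj.
by apply: etrans (row_mxEl _ _ _ _) _; rewrite mxE.
Qed.

Lemma coord_cons_rV0 n p : coord_rV ord0 (@cons_rV n p) = p.1.
Proof. exact: (congr1 fst (cons_rVK p)). Qed.

Lemma coord_cons_rVS n p i : coord_rV (lift ord0 i) (@cons_rV n p) = coord_rV i p.2.
Proof.
rewrite /coord_rV; have -> : lift ord0 i = rshift 1 i by apply/val_inj.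
exact: row_mxEr.
Qed.

Lemma measurable_cons_rV n : measurable_fun setT (@cons_rV n).
Proof.
apply: measurable_fun_rV => i; have [j ->|->] := unliftP ord0 i.
  rewrite (_ : _ \o _ = coord_rV j \o snd); last first.
    by apply/funext => p /=; rewrite coord_cons_rVS.
  by apply: measurableT_comp => //; exact: measurable_coord_rV.
rewrite (_ : _ \o _ = fst)//.
by apply/funext => p /=; rewrite coord_cons_rV0.
Qed.

Lemma measurable_uncons_rV n : measurable_fun setT (@uncons_rV n).
Proof.
apply: measurable_fun_pair; first exact: measurable_coord_rV.
apply: measurable_fun_rV => i.
rewrite (_ : _ \o _ = coord_rV (lift ord0 i)); first exact: measurable_coord_rV.
by apply/funext => x; rewrite /coord_rV/= mxE; congr (x _ _); apply/val_inj.
Qed.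

Lemma sigma_finite_lebesgueX d (T : measurableType d)
    (mu : {sigma_finite_measure set T -> \bar R}) :
  sigma_finite setT (@lebesgue_measure R \x mu).
Proof.
have /sigma_finiteP[F [TF ndF Foo]] := sigma_finiteT (@lebesgue_measure R).
have /sigma_finiteP[G [TG ndG Goo]] := sigma_finiteT mu.
exists (fun n => F n `*` G n).
  rewrite -setXTT TF TG predeqE => -[x y]; split.
    move=> [/= [n _ Fnx] [k _ Gky]]; exists (maxn n k) => //; split.
    - by move: x Fnx; exact/subsetPset/ndF/leq_maxl.
    - by move: y Gky; exact/subsetPset/ndG/leq_maxr.
  by move=> [n _ []/= ? ?]; split; exists n.
move=> k; have [? ?] := Foo k; have [? ?] := Goo k.
split; first exact: measurableX.
by rewrite product_measure1E// lte_mul_pinfty// ge0_fin_numE.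
Qed.

Section step.
Variables (n : nat) (mu : {sigma_finite_measure set 'rV[R]_n -> \bar R}).

Definition cons_measure : set 'rV[R]_n.+1 -> \bar R :=
  pushforward (@lebesgue_measure R \x mu) (@cons_rV n).

Let cons_measure0 : cons_measure set0 = 0.
Proof. by rewrite /cons_measure /pushforward preimage_set0 measure0. Qed.

Let cons_measure_ge0 A : 0 <= cons_measure A.
Proof. by rewrite /cons_measure /pushforward measure_ge0. Qed.

Let cons_measure_sigma_additive : semi_sigma_additive cons_measure.
Proof.
pose m := [the measure _ _ of pushforward (@lebesgue_measure R \x mu)
             (@cons_rV n)].
exact: (@measure_semi_sigma_additive _ _ _ (m (@measurable_cons_rV n))).
Qed.

HB.instance Definition _ := isMeasure.Build _ _ _ cons_measure
  cons_measure0 cons_measure_ge0 cons_measure_sigma_additive.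

Let cons_measure_sigma_finite : sigma_finite setT cons_measure.
Proof.
have [F TF Foo] := sigma_finite_lebesgueX mu.
exists (fun k => @uncons_rV n @^-1` F k).
  by rewrite -preimage_bigcup -TF preimage_setT.
move=> k; have [mF Fk] := Foo k; split.
  by rewrite -[X in measurable X]setTI; exact: measurable_uncons_rV.
rewrite /cons_measure /pushforward -comp_preimage.
by rewrite (_ : _ \o _ = id)// ; apply/funext => p /=; rewrite cons_rVK.
Qed.

HB.instance Definition _ := @Measure_isSigmaFinite.Build _ _ _ cons_measure
  cons_measure_sigma_finite.

End step.

(* Lebesgue measure on R^n: the n-fold product of the one-dimensional one
   (see lebesgue_rV_box); R^0 is a point, of mass 1. *)
Fixpoint lebesgue_rV n : {sigma_finite_measure set 'rV[R]_n -> \bar R} :=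
  if n is n'.+1 then cons_measure (lebesgue_rV n') else \d_(0%R : 'rV[R]_0).

Lemma measurable_box_rV n (A : 'I_n -> set (measurableTypeR R)) :
  (forall i, measurable (A i)) ->
  measurable [set x : 'rV[R]_n | forall i, A i (x ord0 i)].
Proof.
move=> mA.
rewrite (_ : mkset _ = \bigcap_(i in [set: 'I_n]) coord_rV i @^-1` A i).
  apply: fin_bigcap_measurable => // i _.
  by have := measurable_coord_rV i measurableT (mA i); rewrite setTI.
by apply/seteqP; split=> x /= Ax i => [_|]; exact: Ax.
Qed.

Lemma lebesgue_rV_box n (A : 'I_n -> set (measurableTypeR R)) :
  (forall i, measurable (A i)) ->
  lebesgue_rV n [set x | forall i, A i (x ord0 i)] =
  \prod_(i < n) lebesgue_measure (A i).
Proof.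
elim: n A => [|n IH] A mA.
  by rewrite big_ord0 /= diracE mem_set//= => -[].
rewrite big_ord_recl -IH// /= /cons_measure /pushforward.
rewrite -product_measure1E//; last exact: (measurable_box_rV (fun i => mA (lift ord0 i))).
congr (_ _); apply/seteqP; split=> -[a y] /=.
  move=> Ax; split => [|i].
    by have := Ax ord0; rewrite -/(coord_rV _ _) coord_cons_rV0.
  by have := Ax (lift ord0 i); rewrite -/(coord_rV _ _) coord_cons_rVS.
move=> [Aa Ay] i; rewrite -/(coord_rV _ _).
have [j ->|->] := unliftP ord0 i; last by rewrite coord_cons_rV0.
by rewrite coord_cons_rVS; exact: Ay.
Qed.

End lebesgue_rV.

Section euclidean.
Context {R : realType} {n : nat}.
Implicit Types u v : 'rV[R]_n.

Definition dot u v : R := \sum_(i < n) u ord0 i * v ord0 i.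

(* The library's norm `|u| on 'rV[R]_n is the sup norm. *)
Definition enorm u : R := Num.sqrt (dot u u).

(* The integrand is nonnegative, so the default value 0 of the maximum is
   harmless when us is nonempty; the integral is taken in \bar R. *)
Definition P (us : seq 'rV[R]_n) : \bar R :=
  (\int[lebesgue_rV n]_x (\big[Num.max/0%R]_(u <- us) expR (- enorm (x - u) ^+ 2))%:E)%E.

End euclidean.

Definition with_opp (R : realType) (n N : nat) (v : 'I_N -> 'rV[R]_n) :
    seq 'rV[R]_n :=
  flatten [seq [:: v i; - v i] | i <- enum 'I_N].

(* Main.v *)
(** Expanding [|x - u|^2] gives
    [max_i e^(-|x -+ v_i|^2) = e^(-|x|^2) max_i exp (2 |x . v_i| - r_i^2)], so by the
    layer-cake formula [P] is, up to a constant, the integral over [t > 0] of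
    [1 - gamma (S_1 /\ ... /\ S_N)], where [gamma] is the Gaussian measure of density
    proportional to [e^(-|x|^2)] and [S_i] is the slab [|x . v_i| <= (ln t + r_i^2) / 2].
    It therefore suffices that [gamma (S_1 /\ ... /\ S_N) >= prod_i gamma (S_i)] with
    equality for orthogonal [v_i] (Sidak's inequality), since [gamma (S_i)] depends
    only on [|v_i|].

    Slabs are split off one at a time.  A reflection brings [v_1] onto the first
    coordinate axis.  For a symmetric convex [K] the Gaussian measure of the slice of
    [K] at height [t] is even and, by Prekopa's theorem on marginals of log-concave
    functions, log-concave in [t]; hence it decreases with [|t|], and Chebyshev's
    association inequality gives [gamma (S_1 /\ K) >= gamma (S_1) gamma (K)].  If [K] is
    invariant along [v_1] the slices do not depend on [t] and equality holds. *)

Require Import Defs.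
From HB Require Import structures.
From mathcomp Require Import all_boot all_order all_algebra.
From mathcomp Require Import all_classical all_reals all_analysis.
From mathcomp Require Import measurable_realfun ring lra.

Set Implicit Arguments.
Unset Strict Implicit.
Unset Printing Implicit Defensive.
Import Order.TTheory GRing.Theory Num.Theory.
Import numFieldNormedType.Exports.

Local Open Scope classical_set_scope.
Local Open Scope ring_scope.

(** * Lebesgue measure on row vectors *)

Section leb.
Context {R : realType}.
Local Notation mu := (@lebesgue_measure R).
Local Notation lam := (@lebesgue_rV R).
Local Open Scope ereal_scope.

(** Tonelli's theorem, read through the pushforward that defines [cons_measure]. It drives every
    induction on the dimension below. *)
Lemma ge0_integral_cons_rV n (f : 'rV[R]_n.+1 -> \bar R) :
  measurable_fun setT f -> (forall x, 0 <= f x) ->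
  \int[lam n.+1]_x f x = \int[mu]_s \int[lam n]_y f (cons_rV (s, y)).
Proof.
move=> mf f0.
rewrite /= /cons_measure (ge0_integral_pushforward (@measurable_cons_rV R n))//=.
rewrite preimage_setT (fubini_tonelli1 (f \o @cons_rV R n))//=.
by apply: measurableT_comp => //; exact: measurable_cons_rV.
Qed.


(** The translate of Lebesgue measure gives half-open intervals their length, so it is Lebesgue
    measure by uniqueness. *)
Lemma ge0_integral_translation (f : measurableTypeR R -> \bar R) (a : R) :
  measurable_fun setT f -> (forall x, 0 <= f x) ->
  \int[mu]_x f (x + a)%R = \int[mu]_x f x.
Proof.
move=> mf f0.
pose shift (x : measurableTypeR R) : measurableTypeR R := (x + a)%R.
have ma : measurable_fun setT shift by apply: measurable_funD.
transitivity (\int[pushforward mu shift]_x f x).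
  by rewrite (ge0_integral_pushforward ma).
apply: eq_measure_integral => A mA _.
pose nu := [the measure _ _ of pushforward mu shift].
symmetry.
apply: (lebesgue_measure_unique (mu := nu ma)) => //.
move=> X [[x y] _ <-] /=.
rewrite /nu /= /pushforward.
have -> : shift @^-1` `]x, y] = `](x - a)%R, (y - a)%R]%classic.
  by apply/seteqP; split => z /=; rewrite !in_itv /= ltrBlDr lerBrDr.
rewrite !lebesgue_measure_itv /= !lte_fin ltrD2r -!EFinB.
by congr (if _ then _ else _); congr EFin; ring.
Qed.

Lemma cons_rVD n (p q : measurableTypeR R * 'rV[R]_n) :
  (cons_rV p + cons_rV q)%R = cons_rV (p.1 + q.1, p.2 + q.2)%R.
Proof.
apply/rowP => i; rewrite mxE -!/(coord_rV _ _).
by have [j ->|->] := unliftP ord0 i;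
  rewrite ?coord_cons_rV0 ?coord_cons_rVS //= /coord_rV mxE.
Qed.

Lemma cons_rVZ n (a : R) (p : measurableTypeR R * 'rV[R]_n) :
  (a *: cons_rV p)%R = cons_rV (a * p.1, a *: p.2)%R.
Proof.
apply/rowP => i; rewrite mxE -!/(coord_rV _ _).
by have [j ->|->] := unliftP ord0 i;
  rewrite ?coord_cons_rV0 ?coord_cons_rVS //= /coord_rV mxE.
Qed.

Lemma uncons_rVK n : cancel (@uncons_rV R n) (@cons_rV R n).
Proof.
move=> x; apply/rowP => i; rewrite -!/(coord_rV _ _).
have [j ->|->] := unliftP ord0 i; last by rewrite coord_cons_rV0.
by rewrite coord_cons_rVS /uncons_rV /coord_rV /= mxE; congr (x _ _); apply/val_inj.
Qed.

Lemma measurable_addr_rV n :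
  measurable_fun setT (fun p : 'rV[R]_n * 'rV[R]_n => p.1 + p.2)%R.
Proof.
apply: measurable_fun_rV => i.
rewrite (_ : _ \o _ = (fun p => coord_rV i p.1 + coord_rV i p.2)%R); last first.
  by apply/funext => p; rewrite /coord_rV /= mxE.
by apply: measurable_funD; apply: measurableT_comp => //; exact: measurable_coord_rV.
Qed.

Lemma measurable_fun_addr_rV d (T : measurableType d) n (f g : T -> 'rV[R]_n) :
  measurable_fun setT f -> measurable_fun setT g ->
  measurable_fun setT (fun t => f t + g t)%R.
Proof.
move=> mf mg; apply: (measurableT_comp (@measurable_addr_rV n)
  (measurable_fun_pair mf mg)).
Qed.

Lemma measurable_fun_oppr_rV d (T : measurableType d) n (f : T -> 'rV[R]_n) :
  measurable_fun setT f -> measurable_fun setT (fun t => - f t)%R.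
Proof.
move=> mf; apply: measurable_fun_rV => i.
rewrite (_ : _ \o _ = (fun t => - coord_rV i (f t))%R); last first.
  by apply/funext => p; rewrite /coord_rV /= mxE.
by apply: measurable_funN; apply: measurableT_comp => //; exact: measurable_coord_rV.
Qed.

Lemma ge0_integral_rV_translation n (f : 'rV[R]_n -> \bar R) (a : 'rV[R]_n) :
  measurable_fun setT f -> (forall x, 0 <= f x) ->
  \int[lam n]_x f (x + a)%R = \int[lam n]_x f x.
Proof.
elim: n f a => [|n IH] f a mf f0.
  by apply: eq_integral => x _; congr (f _); apply/rowP => -[].
have mcons (g : 'rV[R]_n.+1 -> \bar R) :
    measurable_fun setT g -> measurable_fun setT (g \o @cons_rV R n).
  by move=> mg; apply: measurableT_comp => //; exact: measurable_cons_rV.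
have mfa : measurable_fun setT (fun x : 'rV[R]_n.+1 => f (x + a)%R).
  apply: measurableT_comp => //.
  by apply: measurable_fun_addr_rV => //; exact: measurable_cst.
rewrite !ge0_integral_cons_rV//.
have -> : a = cons_rV (uncons_rV a) by rewrite uncons_rVK.
set b := uncons_rV a.
transitivity (\int[mu]_s \int[lam n]_y f (cons_rV ((s + b.1)%R, y))).
  apply: eq_integral => s _.
  rewrite -(IH (fun y => f (cons_rV ((s + b.1)%R, y))) b.2)//.
    by apply: eq_integral => y _; rewrite cons_rVD.
  apply: (measurableT_comp (mcons f mf)).
  by apply: measurable_fun_pair => //; exact: measurable_cst.
apply: (@ge0_integral_translation (fun s => \int[lam n]_y f (cons_rV (s, y)))).
  exact: (measurable_fun_fubini_tonelli_F (f \o @cons_rV R n) (mcons f mf) (fun p => f0 _)).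
by move=> x; apply: integral_ge0.
Qed.

(** The normal density of variance 1/2: with this normalization the product [gauss] is proportional
    to the factor [e^(-|x|^2)] of the integrand of [P]. *)
Definition gauss1 (s : R) : R := gauss_fun s / Num.sqrt pi.
Definition gauss n (x : 'rV[R]_n) : R := \prod_(i < n) gauss1 (x ord0 i).

Lemma gauss1_gt0 s : (0 < gauss1 s)%R.
Proof. by rewrite /gauss1 divr_gt0 ?expR_gt0// sqrtr_gt0 pi_gt0. Qed.

Lemma gauss_gt0 n (x : 'rV_n) : (0 < gauss x)%R.
Proof. by apply: prodr_gt0 => i _; exact: gauss1_gt0. Qed.

Lemma gaussE n (x : 'rV_n) : gauss x = (expR (- dot x x) / Num.sqrt pi ^+ n)%R.
Proof.
rewrite /gauss big_split /= prodr_const card_ord -exprVn; congr (_ * _)%R.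
rewrite /gauss_fun -expR_sum; congr expR; rewrite /dot -sumrN.
by apply: eq_bigr => i _; rewrite expr2.
Qed.

Lemma gauss_cons_rV n s (y : 'rV_n) : gauss (cons_rV (s, y)) = (gauss1 s * gauss y)%R.
Proof.
rewrite /gauss big_ord_recl -/(coord_rV _ _) coord_cons_rV0; congr (_ * _)%R.
by apply: eq_bigr => i _; rewrite -/(coord_rV _ _) coord_cons_rVS.
Qed.

Lemma measurable_gauss1 : measurable_fun setT gauss1.
Proof. by apply: measurable_funM => //; exact: measurable_gauss_fun. Qed.

Lemma measurable_gauss n : measurable_fun setT (@gauss n).
Proof.
apply: measurable_prod => i _.
by apply: (measurableT_comp measurable_gauss1); exact: measurable_coord_rV.
Qed.

Lemma integral_gauss1 : \int[mu]_s (gauss1 s)%:E = 1.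
Proof.
under eq_integral do rewrite EFinM.
have pi0 : (Num.sqrt pi : R) != 0%R by rewrite gt_eqF// sqrtr_gt0 pi_gt0.
rewrite ge0_integralZr//=; first by rewrite integralT_gauss -EFinM divff.
- by apply/measurable_EFinP; exact: measurable_gauss_fun.
- by move=> x _; rewrite lee_fin gauss_fun_ge0.
Qed.

Lemma integral_gauss n : \int[lam n]_x (gauss x)%:E = 1.
Proof.
elim: n => [|n IH].
  rewrite /= integral_dirac//=; last by apply/measurable_EFinP; exact: measurable_gauss.
  by rewrite diracT mul1e /gauss big_ord0.
rewrite ge0_integral_cons_rV; last 2 first.
- by apply/measurable_EFinP; exact: measurable_gauss.
- by move=> x; rewrite lee_fin ltW// gauss_gt0.
rewrite -[RHS]integral_gauss1; apply: eq_integral => s _.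
under eq_integral do rewrite gauss_cons_rV EFinM.
rewrite ge0_integralZl//= ?IH ?mule1//.
- by apply/measurable_EFinP; exact: measurable_gauss.
- by move=> x _; rewrite lee_fin ltW// gauss_gt0.
- by rewrite lee_fin ltW// gauss1_gt0.
Qed.

(* The uniqueness argument for Haar measure: translation invariance alone moves [T]
   across the double integral of [f (T x) * g y] for an isotropic [g] of integral 1,
   so no determinant or change-of-variables formula is needed. *)
Lemma ge0_integral_rV_isometry n (f : 'rV[R]_n -> \bar R) (T : 'rV[R]_n -> 'rV[R]_n) :
  measurable_fun setT f -> (forall x, 0 <= f x) ->
  measurable_fun setT T -> involutive T -> {morph T : x y / (x + y)%R} ->
  (forall x, dot (T x) (T x) = dot x x) ->
  \int[lam n]_x f (T x) = \int[lam n]_x f x.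
Proof.
move=> mf f0 mT TK TD Tdot.
pose g (x : 'rV[R]_n) : \bar R := (gauss x)%:E.
have g0 x : 0 <= g x by rewrite lee_fin ltW// gauss_gt0.
have mg : measurable_fun setT g by apply/measurable_EFinP; exact: measurable_gauss.
have gNT x : g (- T x)%R = g x.
  rewrite /g !gaussE; congr ((expR (- _) / _)%R)%:E.
  by rewrite -(Tdot x) /dot; apply: eq_bigr => i _; rewrite !mxE mulrNN.
have mfT : measurable_fun setT (f \o T) by exact: measurableT_comp.
(* Insert the factor 1, written as the integral of a translate of [g]. *)
transitivity (\int[lam n]_x \int[lam n]_y (f (T x) * g (y - T x)%R)).
  apply: eq_integral => x _.
  rewrite ge0_integralZl//; last first.
    apply: measurableT_comp => //.
    by apply: measurable_fun_addr_rV => //; exact: measurable_cst.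
  by rewrite (@ge0_integral_rV_translation _ g)// integral_gauss mule1.
transitivity (\int[lam n]_y \int[lam n]_x (f (T x) * g (y - T x)%R)).
  apply: (fubini_tonelli (fun p : 'rV[R]_n * 'rV[R]_n =>
    f (T p.1) * g (p.2 - T p.1)%R)); last first.
    by move=> x; exact: mule_ge0.
  apply: emeasurable_funM.
    by apply: (measurableT_comp mfT).
  apply: measurableT_comp => //; apply: measurable_fun_addr_rV => //.
  by apply: measurable_fun_oppr_rV; exact: measurableT_comp.
(* Substitute [x + T y] for [x]: since [T] is an additive involution, [T x] becomes [T x + y] and
   [y - T x] becomes [- T x], where [g] has the same value as at [x]. *)
transitivity (\int[lam n]_y \int[lam n]_x (f (T x + y)%R * g x)).
  apply: eq_integral => y _.
  rewrite -(@ge0_integral_rV_translation _ (fun x => f (T x) * g (y - T x)%R) (T y)).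
  - apply: eq_integral => x _; rewrite TD TK; congr (_ * _).
    by rewrite opprD addrCA subrr addr0 gNT.
  - apply: emeasurable_funM => //.
    apply: measurableT_comp => //.
    apply: measurable_fun_addr_rV; first exact: measurable_cst.
    exact: measurable_fun_oppr_rV.
  - by move=> x; exact: mule_ge0.
transitivity (\int[lam n]_x \int[lam n]_y (f (T x + y)%R * g x)).
  apply/esym/(fubini_tonelli (fun p : 'rV[R]_n * 'rV[R]_n =>
    f (T p.1 + p.2)%R * g p.1)); last first.
    by move=> x; exact: mule_ge0.
  apply: emeasurable_funM; last exact: measurableT_comp.
  apply: measurableT_comp => //; apply: measurable_fun_addr_rV => //.
  exact: measurableT_comp.
transitivity (\int[lam n]_x (g x * \int[lam n]_y f y)).
  apply: eq_integral => x _.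
  rewrite ge0_integralZr//; last first.
    apply: measurableT_comp => //.
    by apply: measurable_fun_addr_rV => //; exact: measurable_cst.
  rewrite muleC; congr (_ * _).
  under eq_integral do rewrite addrC.
  exact: ge0_integral_rV_translation.
by rewrite ge0_integralZr ?integral_gauss ?mul1e//; exact: integral_ge0.
Qed.

End leb.

(** * Prekopa's inequality on the line *)

Section layer_cake.
Context {R : realType} d (T : measurableType d).
Variable m : {sigma_finite_measure set T -> \bar R}.
Local Notation mu := (@lebesgue_measure R).
Local Open Scope ereal_scope.

Variables (f : T -> R) (w : T -> \bar R).
Hypotheses (mf : measurable_fun setT f) (f0 : forall x, (0 <= f x)%R).
Hypotheses (mw : measurable_fun setT w) (w0 : forall x, 0 <= w x).

Let cut (p : T * measurableTypeR R) := if (0 < p.2 < f p.1)%R then w p.1 else 0.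

Let measurable_cut : measurable_fun setT cut.
Proof.
apply: measurable_fun_ifT => //; last exact: measurableT_comp.
apply: measurable_and; first by apply: measurable_fun_ltr.
by apply: measurable_fun_ltr => //; exact: measurableT_comp.
Qed.

Let cut_ge0 p : 0 <= cut p.
Proof. by rewrite /cut; case: ifP. Qed.

Lemma measurable_layer :
  measurable_fun setT (fun t : measurableTypeR R =>
    \int[m]_x (if (0 < t < f x)%R then w x else 0)).
Proof. exact: (measurable_fun_fubini_tonelli_G cut measurable_cut cut_ge0). Qed.

(** Tonelli on the region under the graph of [f]. The weight [w] is the constant 1 in Prekopa's
    inequality and the Gaussian density when the formula is applied to [P]. *)
Lemma ge0_integral_layer_cake :
  \int[m]_x ((f x)%:E * w x) =
  \int[mu]_t \int[m]_x (if (0 < t < f x)%R then w x else 0).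
Proof.
rewrite -(fubini_tonelli cut measurable_cut cut_ge0).
apply: eq_integral => x _.
rewrite [RHS](_ : _ = \int[mu]_(t in `]0%R, f x[) cst (w x) t).
  rewrite integral_cst//. rewrite [X in _ = _ * X]lebesgue_measure_itv/= lte_fin.
  have := f0 x; rewrite le_eqVlt => /orP[/eqP <-|->].
    by rewrite ltxx mul0e mule0.
  by rewrite oppr0 adde0 muleC.
rewrite [RHS]integral_mkcond; apply: eq_integral => t _.
rewrite patchE /cut/=; case: ifPn => [t0|t0].
  by rewrite mem_set//= in_itv.
by rewrite memNset//= in_itv/=; exact/negP.
Qed.

End layer_cake.

(** * Brunn-Minkowski and Prekopa inequalities in dimension one *)

Section prekopa1.
Context {R : realType}.
Local Notation mu := (@lebesgue_measure R).

(** Brunn-Minkowski for bounded intervals: [C] contains the open interval from the combination of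
    the infima to that of the suprema, and its length is the same combination of the lengths of [A]
    and [B]. *)
Lemma le_lebesgue_measure_convex_comb (l : R) (A B C : set R) :
  0 < l < 1 ->
  (A !=set0) -> (B !=set0) -> has_ubound A -> has_lbound A ->
  has_ubound B -> has_lbound B ->
  measurable A -> measurable B -> measurable C ->
  (forall t x y, 0 < t < 1 -> A x -> A y -> A (t * x + (1 - t) * y)) ->
  (forall t x y, 0 < t < 1 -> B x -> B y -> B (t * x + (1 - t) * y)) ->
  (forall x y, A x -> B y -> C (l * x + (1 - l) * y)) ->
  (l%:E * mu A + (1 - l)%:E * mu B <= mu C)%E.
Proof.
move=> /andP[l0 l1] A0 B0 uA lA uB lB mA mB mC cA cB ABC.
have muA (X : set R) : X !=set0 -> has_ubound X -> has_lbound X -> measurable X ->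
    inf X <= sup X /\ (mu X <= (sup X - inf X)%:E)%E.
  move=> X0 uX lX mX.
  have XI : X `<=` `[inf X, sup X].
    move=> x Xx /=; rewrite in_itv/=; apply/andP; split.
      exact: ge_inf.
    exact: ub_le_sup.
  have i_s : inf X <= sup X.
    by have [x /XI] := X0; rewrite /= in_itv/= => /andP[]; exact: le_trans.
  split=> //.
  apply: (@le_trans _ _ (mu `[inf X, sup X])).
    by apply: le_measure => //; rewrite inE//; exact: measurable_itv.
  rewrite lebesgue_measure_itv/= lte_fin; case: ifP => _; first by rewrite -EFinB.
  by rewrite lee_fin subr_ge0.
have [iA mA'] := muA _ A0 uA lA mA.
have [iB mB'] := muA _ B0 uB lB mB.
have l1' : 0 < 1 - l by rewrite subr_gt0.
pose lo := l * inf A + (1 - l) * inf B.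
pose hi := l * sup A + (1 - l) * sup B.
have sC : `]lo, hi[ `<=` C.
  move=> p /=; rewrite in_itv/= => /andP[lop phi].
  (* These tolerances are what makes the combinations of nearly extremal points satisfy
     [q0 < p < q1]. *)
  have e0 : 0 < p - lo by rewrite subr_gt0.
  have e1 : 0 < hi - p by rewrite subr_gt0.
  have [a0 Aa0 a0i] := inf_adherent e0 (conj A0 lA).
  have [b0 Bb0 b0i] := inf_adherent e0 (conj B0 lB).
  have [a1 Aa1 a1i] := sup_adherent e1 (conj A0 uA).
  have [b1 Bb1 b1i] := sup_adherent e1 (conj B0 uB).
  pose q0 := l * a0 + (1 - l) * b0.
  pose q1 := l * a1 + (1 - l) * b1.
  have q0p : q0 < p by rewrite /q0; rewrite /lo in a0i b0i *; nra.
  have pq1 : p < q1 by rewrite /q1; rewrite /hi in a1i b1i *; nra.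
  have q01 : 0 < q1 - q0 by lra.
  (* The weight with [p = t * q0 + (1 - t) * q1]. Using it in both [A] and [B] exhibits [p] as an
     [l]-combination of a point of each. *)
  pose t := (q1 - p) / (q1 - q0).
  have t01 : 0 < t < 1.
    rewrite /t divr_gt0//= ?subr_gt0// ltr_pdivrMr// mul1r; lra.
  have tq : t * (q1 - q0) = q1 - p by rewrite /t divfK// gt_eqF.
  clearbody t.
  have -> : p = l * (t * a0 + (1 - t) * a1) + (1 - l) * (t * b0 + (1 - t) * b1).
    by rewrite /q1 /q0 in tq; lra.
  by apply: ABC; [exact: cA|exact: cB].
apply: (@le_trans _ _ (mu `]lo, hi[)); last first.
  by apply: le_measure => //; rewrite inE//; exact: measurable_itv.
apply: (@le_trans _ _ (l * (sup A - inf A) + (1 - l) * (sup B - inf B))%:E).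
  rewrite [X in (_ <= X)%E]EFinD !EFinM; apply: leeD.
    by apply: lee_wpmul2l => //; rewrite lee_fin ltW.
  by apply: lee_wpmul2l => //; rewrite lee_fin ltW.
rewrite lebesgue_measure_itv/= lte_fin; case: ifPn => [_|].
  by rewrite -EFinB lee_fin /lo /hi; lra.
by rewrite -leNgt lee_fin /lo /hi; nra.
Qed.

(** Weighted arithmetic-geometric mean, obtained from Young's inequality with the conjugate
    exponents [1 / l] and [1 / (1 - l)]. *)
Lemma powR_mean (l x y : R) : 0 < l < 1 -> 0 <= x -> 0 <= y ->
  x `^ l * y `^ (1 - l) <= l * x + (1 - l) * y.
Proof.
move=> /andP[l0 l1] x0 y0.
have l1' : 0 < 1 - l by rewrite subr_gt0.
have := @conjugate_powR R (x `^ l) (y `^ (1 - l)) l^-1 (1 - l)^-1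
  (powR_ge0 _ _) (powR_ge0 _ _).
rewrite !invr_gt0 !invrK -!powRrM !mulfV ?gt_eqF// !powRr1// [x * _]mulrC [y * _]mulrC.
by apply => //; ring.
Qed.


(** Powers rather than logarithms allow [f] to vanish. The general module [V] lets a coordinate be
    moved into the parameter space when marginals are taken. *)
Definition log_concave (V : lmodType R) (f : V -> R) := forall (t : R) x y,
  0 < t < 1 -> f x `^ t * f y `^ (1 - t) <= f (t *: x + (1 - t) *: y).

Lemma powR_onem (t s : R) : 0 < t < 1 -> 0 <= s -> s `^ t * s `^ (1 - t) = s.
Proof.
move=> /andP[t0 t1]; rewrite le_eqVlt => /orP[/eqP <-|s0].
  by rewrite powR0 ?mul0r// gt_eqF.
by rewrite -powRD ?(gt_eqF s0) ?implybT// addrC subrK powRr1// ltW.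
Qed.

(** A weighted geometric mean is at least the minimum of its two terms. *)
Lemma log_concave_superlevel (V : lmodType R) (f : V -> R) (s t : R) x y :
  log_concave f -> (forall z, 0 <= f z) -> 0 <= s -> 0 < t < 1 ->
  s < f x -> s < f y -> s < f (t *: x + (1 - t) *: y).
Proof.
move=> lf f0 s0 t01 sx sy.
apply: (@lt_le_trans _ _ (Num.min (f x) (f y))); first by rewrite lt_min sx.
have m0 : 0 <= Num.min (f x) (f y) by rewrite le_min !f0.
apply: le_trans (lf _ _ _ t01); have /andP[t0 t1] := t01.
rewrite -[leLHS](powR_onem t01 m0).
by apply: ler_pM; rewrite ?powR_ge0//; apply: ge0_ler_powR;
  rewrite ?nnegrE ?f0 ?subr_ge0 ?(ltW t0) ?(ltW t1) ?ge_min ?lexx ?orbT.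
Qed.

(** Makes the infima and suprema of superlevel sets meaningful in the Brunn-Minkowski step;
    domination by a Gaussian will provide it. *)
Definition bounded_superlevels (f : R -> R) :=
  forall s, 0 < s -> exists K, forall x, s < f x -> `|x| <= K.

(* When both suprema are 1, the superlevel sets of [f0] and [f1] at each level
   [0 < s < 1] are nonempty intervals, and Brunn-Minkowski on the line applies to them. *)
Lemma prekopa_sup1 (l : R) (f0 f1 h : R -> R) : 0 < l < 1 ->
  measurable_fun setT f0 -> measurable_fun setT f1 -> measurable_fun setT h ->
  (forall x, 0 <= f0 x) -> (forall x, 0 <= f1 x) -> (forall x, 0 <= h x) ->
  @log_concave R^o f0 -> @log_concave R^o f1 ->
  bounded_superlevels f0 -> bounded_superlevels f1 ->
  (forall x, f0 x <= 1) -> (forall x, f1 x <= 1) ->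
  (forall s, s < 1 -> exists x, s < f0 x) -> (forall s, s < 1 -> exists x, s < f1 x) ->
  (forall x y, f0 x `^ l * f1 y `^ (1 - l) <= h (l * x + (1 - l) * y)) ->
  (l%:E * (\int[mu]_x (f0 x)%:E) + (1 - l)%:E * (\int[mu]_x (f1 x)%:E) <=
    \int[mu]_x (h x)%:E)%E.
Proof.
move=> l01 mf0 mf1 mh f00 f10 h0 lc0 lc1 b0 b1 le0 le1 s0 s1 fh.
have /andP[l0 l1] := l01.
have mS (f : R -> R) s : measurable_fun setT f -> measurable [set x | s < f x].
  move=> mf.
  have : measurable_fun setT (fun x => s < f x) by apply: measurable_fun_ltr.
  by move=> /(_ measurableT [set true]); rewrite setTI; exact.
pose L (f : R -> R) (s : measurableTypeR R) : \bar R :=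
  (\int[mu]_x (if (0 < s < f x)%R then 1 else 0))%E.
have L0 f s : (0 <= L f s)%E by apply: integral_ge0 => x _; case: ifP.
have mL (f : R -> R) : measurable_fun setT f -> measurable_fun setT (L f).
  by move=> mf; exact: (measurable_layer mu mf (measurable_cst 1%E) (fun=> lee01)).
have LE (f : R -> R) (s : R) : measurable_fun setT f -> 0 < s -> L f s = mu [set x | s < f x].
  move=> mf s_0; transitivity (\int[mu]_(x in [set x | (s < f x)%R]) cst 1 x)%E; last first.
    by rewrite integral_cst ?mul1e//; exact: mS.
  rewrite /L [RHS]integral_mkcond; apply: eq_integral => x _ /=; rewrite patchE s_0/=.
  case: ifPn => sf; first by rewrite mem_set.
  by rewrite memNset//=; exact/negP.
have layer (f : R -> R) : measurable_fun setT f -> (forall x, 0 <= f x) ->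
    (\int[mu]_x (f x)%:E = \int[mu]_s L f s)%E.
  move=> mf f_0.
  transitivity (\int[mu]_x ((f x)%:E * cst 1 x))%E.
    by apply: eq_integral => x _; rewrite mule1.
  by rewrite ge0_integral_layer_cake.
have L_le0 (f : R -> R) (s : R) : s <= 0 -> L f s = 0%E.
  by move=> s_0; rewrite /L; apply: integral0_eq => x _; rewrite ltNge s_0.
have L_ge1 (f : R -> R) (s : R) : (forall x, f x <= 1) -> 1 <= s -> L f s = 0%E.
  move=> f_1 s_1; rewrite /L; apply: integral0_eq => x _.
  by rewrite (ltNge s) (le_trans (f_1 x) s_1) andbF.
rewrite !layer//.
have bb (f : R -> R) : bounded_superlevels f -> forall s, 0 < s ->
    has_ubound [set x | s < f x] /\ has_lbound [set x | s < f x].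
  move=> bf s s_0; have [K HK] := bf s s_0; split; [exists K|exists (- K)] => x /= /HK.
    by rewrite ler_norml => /andP[].
  by rewrite ler_norml => /andP[].
rewrite -!ge0_integralZl//; [|exact: mL|by rewrite lee_fin; lra|exact: mL|by rewrite lee_fin; lra].
rewrite -ge0_integralD//; last 4 first.
- by move=> s _; rewrite mule_ge0// lee_fin; lra.
- by apply: measurable_funeM; exact: mL.
- by move=> s _; rewrite mule_ge0// lee_fin; lra.
- by apply: measurable_funeM; exact: mL.
apply: ge0_le_integral => //.
- by move=> s _; rewrite adde_ge0// mule_ge0// lee_fin; lra.
- by apply: emeasurable_funD; apply: measurable_funeM; exact: mL.
- exact: mL.
(* Compare layer by layer. All layers vanish for [s <= 0], and those of [f0] and [f1] vanish for
   [s >= 1]; Brunn-Minkowski handles the levels in between. *)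
move=> s _; have [s_0|s_0] := leP s 0.
  by rewrite !L_le0// !mule0 adde0.
have [s_1|s_1] := leP 1 s.
  by rewrite !(L_ge1 f0) ?(L_ge1 f1)// !mule0 adde0.
have [u0 v0] := bb f0 b0 s s_0; have [u1 v1] := bb f1 b1 s s_0.
rewrite !LE//; apply: le_lebesgue_measure_convex_comb => //.
- by have [x Hx] := s0 _ s_1; exists x.
- by have [x Hx] := s1 _ s_1; exists x.
- exact: mS.
- exact: mS.
- exact: mS.
- by move=> t x y t01 /= sx sy; apply: (log_concave_superlevel lc0) => //; exact: ltW.
- by move=> t x y t01 /= sx sy; apply: (log_concave_superlevel lc1) => //; exact: ltW.
- move=> x y /= sx sy; apply: lt_le_trans (fh x y).
  have m0 : s < Num.min (f0 x) (f1 y) by rewrite lt_min sx.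
  apply: (lt_le_trans m0).
  rewrite -[leLHS](powR_onem l01) ?le_min ?f00 ?f10//.
  apply: ler_pM; rewrite ?powR_ge0//; apply: ge0_ler_powR;
    by rewrite ?nnegrE ?le_min ?f00 ?f10 ?subr_ge0 ?(ltW l0) ?(ltW l1) ?ge_min ?lexx ?orbT.
Qed.

(** Dividing [f0], [f1] by their suprema and [h] by the geometric mean of these reduces to suprema
    equal to 1. The arithmetic mean obtained there dominates the geometric mean, which scales back
    correctly. *)
Lemma prekopa1 (l K : R) (f0 f1 h : R -> R) (I0 I1 : R) : 0 < l < 1 ->
  measurable_fun setT f0 -> measurable_fun setT f1 -> measurable_fun setT h ->
  (forall x, 0 <= f0 x <= K) -> (forall x, 0 <= f1 x <= K) -> (forall x, 0 <= h x) ->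
  @log_concave R^o f0 -> @log_concave R^o f1 ->
  bounded_superlevels f0 -> bounded_superlevels f1 ->
  (forall x y, f0 x `^ l * f1 y `^ (1 - l) <= h (l * x + (1 - l) * y)) ->
  (\int[mu]_x (f0 x)%:E = I0%:E)%E -> (\int[mu]_x (f1 x)%:E = I1%:E)%E ->
  ((I0 `^ l * I1 `^ (1 - l))%:E <= \int[mu]_x (h x)%:E)%E.
Proof.
move=> l01 mf0 mf1 mh f0K f1K h0 lc0 lc1 b0 b1 fh I0E I1E.
have /andP[l0 l1] := l01.
have l1' : 0 < 1 - l by rewrite subr_gt0.
have f00 x : 0 <= f0 x by have /andP[] := f0K x.
have f10 x : 0 <= f1 x by have /andP[] := f1K x.
have bigh : (0 <= \int[mu]_x (h x)%:E)%E by apply: integral_ge0 => x _; rewrite lee_fin.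
have supP (f : R -> R) : (forall x, 0 <= f x <= K) ->
    (forall x, f x = 0) \/ exists M, [/\ 0 < M, forall x, f x <= M &
      forall s, s < M -> exists x, s < f x].
  move=> fK.
  have hs : has_sup (range f).
    by split; [exists (f 0), 0|exists K => _ [x _ <-]; have /andP[] := fK x].
  have fM x : f x <= sup (range f) by apply: ub_le_sup; [exact: hs.2|exists x].
  have := le_trans (proj1 (andP (fK 0))) (fM 0).
  rewrite le_eqVlt => /orP[/eqP M0|M0].
    left=> x; apply/le_anti; rewrite (proj1 (andP (fK x))) andbT.
    by rewrite (le_trans (fM x))// -M0.
  right; exists (sup (range f)); split=> // s sM.
  have e0 : 0 < sup (range f) - s by rewrite subr_gt0.
  have [_ [x _ <-]] := sup_adherent e0 hs.
  by rewrite subKr => ?; exists x.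
have int0 (f : R -> R) I : (forall x, f x = 0) -> (\int[mu]_x (f x)%:E = I%:E)%E -> I = 0.
  move=> f_0; rewrite integral0_eq => [[]//|x _]; by rewrite f_0.
(* If a supremum is 0 no rescaling is possible, but then the integral is 0, and so is its positive
   power on the left-hand side. *)
have [f0_0|[M0 [M0_gt0 f0M M0s]]] := supP f0 f0K.
  by rewrite (int0 f0 I0)// powR0 ?mul0r// gt_eqF.
have [f1_0|[M1 [M1_gt0 f1M M1s]]] := supP f1 f1K.
  by rewrite (int0 f1 I1)// powR0 ?mulr0// gt_eqF.
pose c := M0 `^ l * M1 `^ (1 - l).
have c0 : 0 < c by rewrite mulr_gt0// powR_gt0.
have scale (f : R -> R) (M I : R) : measurable_fun setT f -> (forall x, 0 <= f x) -> 0 < M ->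
   (\int[mu]_x (f x)%:E = I%:E -> \int[mu]_x (M^-1 * f x)%:E = (M^-1 * I)%:E)%E.
  move=> mf f_0 M_0 fI; under eq_integral do rewrite EFinM.
  rewrite ge0_integralZl//; first by rewrite fI.
  - exact/measurable_EFinP.
  - by move=> x _; rewrite lee_fin.
  - by rewrite lee_fin invr_ge0 ltW.
have lcs (f : R -> R) M : 0 < M -> (forall x, 0 <= f x) -> @log_concave R^o f ->
    @log_concave R^o (fun x => M^-1 * f x).
  move=> M_0 f_0 lf t x y t01.
  have Mi : 0 <= M^-1 by rewrite invr_ge0 ltW.
  rewrite !powRM// mulrACA powR_onem//.
  by apply: ler_wpM2l => //; exact: lf.
have bs (f : R -> R) M : 0 < M -> bounded_superlevels f ->
    bounded_superlevels (fun x => M^-1 * f x).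
  move=> M_0 bf s s_0; have [k Hk] := bf (M * s) (mulr_gt0 M_0 s_0); exists k => x.
  by rewrite mulrC ltr_pdivlMr// mulrC; exact: Hk.
have sup1 (f : R -> R) M : 0 < M -> (forall s, s < M -> exists x, s < f x) ->
    forall s, s < 1 -> exists x, s < M^-1 * f x.
  move=> M_0 sM s s_1; have [|x Hx] := sM (M * s); first by rewrite gtr_pMr.
  by exists x; rewrite mulrC ltr_pdivlMr// mulrC.
have I0_ge0 : 0 <= I0 by rewrite -lee_fin -I0E; apply: integral_ge0 => x _; rewrite lee_fin.
have I1_ge0 : 0 <= I1 by rewrite -lee_fin -I1E; apply: integral_ge0 => x _; rewrite lee_fin.
have mM (f : R -> R) M : measurable_fun setT f -> measurable_fun setT (fun x => M^-1 * f x : R).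
  by move=> mf; apply: measurable_funM.
have pM (f : R -> R) M x : 0 < M -> 0 <= f x -> 0 <= M^-1 * f x.
  by move=> M_0 f_0; rewrite mulr_ge0// invr_ge0 ltW.
have key := @prekopa_sup1 l (fun x => M0^-1 * f0 x) (fun x => M1^-1 * f1 x)
  (fun x => c^-1 * h x) l01 (mM _ _ mf0) (mM _ _ mf1) (mM _ _ mh)
  (fun x => pM f0 M0 x M0_gt0 (f00 x)) (fun x => pM f1 M1 x M1_gt0 (f10 x))
  (fun x => pM h c x c0 (h0 x))
  (lcs _ _ M0_gt0 f00 lc0) (lcs _ _ M1_gt0 f10 lc1) (bs _ _ M0_gt0 b0) (bs _ _ M1_gt0 b1).
have {}key : ((l * (M0^-1 * I0) + (1 - l) * (M1^-1 * I1))%:E <=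
    (c^-1)%:E * \int[mu]_x (h x)%:E)%E.
  rewrite -ge0_integralZl//; last 3 first.
  - exact/measurable_EFinP.
  - by move=> x _; rewrite lee_fin.
  - by rewrite lee_fin invr_ge0 ltW.
  under eq_integral do rewrite -EFinM.
  rewrite EFinD !(EFinM _ (_^-1 * _)) -(scale f0 M0 I0)// -(scale f1 M1 I1)//.
  apply: key.
  - by move=> x; rewrite mulrC ler_pdivrMr// mul1r.
  - by move=> x; rewrite mulrC ler_pdivrMr// mul1r.
  - exact: sup1.
  - exact: sup1.
  - move=> x y; rewrite !powRM ?invr_ge0 ?(ltW M0_gt0) ?(ltW M1_gt0)//.
    rewrite mulrACA.
    have -> : M0^-1 `^ l * M1^-1 `^ (1 - l) = c^-1.
      by rewrite /c invfM -!powR_inv1 ?powR_ge0 ?ltW// -!powRrM ![_ * -1]mulrC.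
    by rewrite ler_pM2l ?invr_gt0.
have MI0 : I0 = M0 * (M0^-1 * I0) by rewrite mulrA mulfV ?mul1r// gt_eqF.
have MI1 : I1 = M1 * (M1^-1 * I1) by rewrite mulrA mulfV ?mul1r// gt_eqF.
have J0 : 0 <= M0^-1 * I0 by rewrite mulr_ge0// invr_ge0 ltW.
have J1 : 0 <= M1^-1 * I1 by rewrite mulr_ge0// invr_ge0 ltW.
rewrite MI0 MI1 (powRM _ (ltW M0_gt0) J0) (powRM _ (ltW M1_gt0) J1) mulrACA -/c EFinM.
have -> : (\int[mu]_x (h x)%:E = c%:E * (c^-1%:E * \int[mu]_x (h x)%:E))%E.
  by rewrite muleA -EFinM divff ?mul1e// gt_eqF.
apply: lee_wpmul2l; first by rewrite lee_fin ltW.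
by apply: le_trans key; rewrite lee_fin powR_mean.
Qed.
End prekopa1.

(** * Marginals of log-concave functions *)

Section marginal.
Context {R : realType}.
Local Notation mu := (@lebesgue_measure R).
Local Notation lam := (@lebesgue_rV R).

Lemma gauss1_le_gauss_fun (x : R) : gauss1 x <= gauss_fun x.
Proof.
rewrite ler_pdivrMr ?sqrtr_gt0 ?pi_gt0// ler_peMr ?gauss_fun_ge0//.
by rewrite -sqrtr1 ler_wsqrtr// (le_trans _ (pi_ge2 R))// ler1n.
Qed.

Lemma gauss1_le1 (x : R) : gauss1 x <= 1.
Proof. exact: le_trans (gauss1_le_gauss_fun x) (gauss_fun_le1 x). Qed.

(** From [|x| <= 1 + x^2 <= e^(x^2)], a value [e^(-x^2) > s] forces [|x| <= 1 / s]. *)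
Lemma bounded_superlevels_gauss1 (f : R -> R) :
  (forall x, f x <= gauss1 x) -> bounded_superlevels f.
Proof.
move=> fg s s0; exists s^-1 => x /lt_le_trans - /(_ _ (fg x)).
move=> /lt_le_trans - /(_ _ (gauss1_le_gauss_fun x)).
rewrite /gauss_fun expRN => sx.
rewrite -[leRHS]mul1r ler_pdivlMr//; apply: ltW.
have e0 := expR_gt0 (x ^+ 2).
apply: (@le_lt_trans _ _ (expR (x ^+ 2) * s)); last first.
  by rewrite mulrC -ltr_pdivlMr// mul1r.
rewrite ler_wpM2r ?(ltW s0)//.
apply: le_trans (expR_ge1Dx _).
by rewrite -(real_normK (num_real x)); have := sqr_ge0 (`|x| - 1); nra.
Qed.

(** [fine] loses nothing in the uses below, where [f v] is dominated by a multiple of the Gaussian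
    density and so has a finite integral. *)
Definition marginal (V : Type) n (f : V -> 'rV[R]_n -> R) (v : V) : R :=
  fine (\int[lam n]_y (f v y)%:E).

Section dominated.
Context n (c : R) (f : 'rV[R]_n -> R).
Hypotheses (mf : measurable_fun setT f) (c0 : 0 <= c).
Hypothesis fg : forall y, 0 <= f y <= c * gauss y.

Lemma dominated_integral_ge0 : (0 <= \int[lam n]_y (f y)%:E)%E.
Proof. by apply: integral_ge0 => y _; rewrite lee_fin; have /andP[] := fg y. Qed.

Lemma dominated_integral_le : (\int[lam n]_y (f y)%:E <= c%:E)%E.
Proof.
rewrite -[leRHS]mule1 -(integral_gauss (R := R) n) -ge0_integralZl//.
- apply: ge0_le_integral => //.
  + by move=> y _; rewrite lee_fin; have /andP[] := fg y.
  + exact/measurable_EFinP.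
  + by apply: measurable_funeM; apply/measurable_EFinP; exact: measurable_gauss.
  + by move=> y _; rewrite -EFinM lee_fin; have /andP[] := fg y.
- by apply/measurable_EFinP; exact: measurable_gauss.
- by move=> y _; rewrite lee_fin ltW// gauss_gt0.
Qed.

Lemma dominated_fineK :
  ((fine (\int[lam n]_y (f y)%:E))%:E = \int[lam n]_y (f y)%:E)%E.
Proof.
rewrite fineK// ge0_fin_numE ?dominated_integral_ge0//.
exact: le_lt_trans dominated_integral_le (ltry _).
Qed.

Lemma dominated_fine_bounds : 0 <= fine (\int[lam n]_y (f y)%:E) <= c.
Proof.
by rewrite -!lee_fin dominated_fineK dominated_integral_ge0 dominated_integral_le.
Qed.

End dominated.

(** Prekopa's theorem by induction on the dimension: the first coordinate of [y] joins the
    parameter, the induction hypothesis integrates out the others, and the one-dimensional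
    inequality integrates out that coordinate. *)
Lemma marginal_log_concave n (V : lmodType R) (f : V -> 'rV[R]_n -> R) :
  (forall v, measurable_fun setT (f v)) ->
  (forall v y, 0 <= f v y <= gauss y) ->
  log_concave (fun p : V * 'rV[R]_n => f p.1 p.2) ->
  log_concave (marginal f).
Proof.
elim: n V f => [|n IH] V f mf fg lf t v w t01.
  have E u : marginal f u = f u 0.
    by rewrite /marginal /= integral_dirac ?diracT ?mul1e//; exact/measurable_EFinP.
  rewrite !E; have := lf t (v, 0) (w, 0) t01.
  by rewrite /= !scaler0 addr0.
pose F (p : V * R^o) (y : 'rV[R]_n) := f p.1 (cons_rV (p.2 : R, y)).
have mF p : measurable_fun setT (F p).
  apply: (measurableT_comp (mf p.1)).
  apply: (measurableT_comp (@measurable_cons_rV R n)).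
  by apply: measurable_fun_pair => //; exact: measurable_cst.
(* Keeping the factor [gauss1] gives the partial marginal its decay in the remaining coordinate,
   hence bounded superlevel sets. *)
have Fg p y : 0 <= F p y <= gauss1 (p.2 : R) * gauss y.
  by rewrite -gauss_cons_rV; exact: fg.
have Fg1 p y : 0 <= F p y <= gauss y.
  have /andP[-> /le_trans] := Fg p y; apply.
  by rewrite ler_piMl ?gauss1_le1// ltW// gauss_gt0.
have lF : log_concave (fun p : (V * R^o) * 'rV[R]_n => F p.1 p.2).
  move=> s [[v1 s1] y1] [[v2 s2] y2] s01 /=.
  have := lf s (v1, cons_rV (s1 : R, y1)) (v2, cons_rV (s2 : R, y2)) s01.
  rewrite /F /=; congr (_ <= f _ _).
  by rewrite !cons_rVZ cons_rVD.
have lG := IH _ F mF Fg1 lF.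
have g10 x : 0 <= gauss1 (x : R) by rewrite ltW// gauss1_gt0.
have FK u s := dominated_fineK (mF (u, s)) (g10 _) (Fg (u, s)).
have mG u : measurable_fun setT (fun s : R => marginal F (u, s)).
  apply/measurable_EFinP.
  rewrite (_ : _ \o _ = fun s => \int[lam n]_y (f u (cons_rV (s, y)))%:E)%E; last first.
    by apply/funext => s /=; exact: FK.
  apply: (measurable_fun_fubini_tonelli_F (fun p => (f u (cons_rV p))%:E)).
    apply/measurable_EFinP; apply: (measurableT_comp (mf u)).
    exact: measurable_cons_rV.
  by move=> p; rewrite lee_fin; have /andP[] := fg u (cons_rV p).
have intE u : (\int[lam n.+1]_y (f u y)%:E = \int[mu]_s (marginal F (u, s : R^o))%:E)%E.
  rewrite ge0_integral_cons_rV; last 2 first.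
    exact/measurable_EFinP.
    by move=> y; rewrite lee_fin; have /andP[] := fg u y.
  by apply: eq_integral => s _; rewrite FK.
have f1g u y : 0 <= f u y <= 1 * gauss y by rewrite mul1r.
have fK u := dominated_fineK (mf u) ler01 (f1g u).
have Gb u (s : R) := dominated_fine_bounds (mF (u, s)) (g10 _) (Fg (u, s)).
rewrite -lee_fin [X in (_ <= X)%E]fK intE.
apply: (prekopa1 (K := 1) t01 (mG v) (mG w)) => //.
- by move=> s; have /andP[-> /le_trans] := Gb v s; apply; exact: gauss1_le1.
- by move=> s; have /andP[-> /le_trans] := Gb w s; apply; exact: gauss1_le1.
- by move=> s; have /andP[] := Gb (t *: v + (1 - t) *: w) s.
- move=> s x y s01; have lGs := lG s (v, x) (v, y) s01.
  suff <- : s *: (v, x : R^o) + (1 - s) *: (v, y : R^o) = (v, s * x + (1 - s) * y) :> V * R^o.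
    exact: lGs.
  by congr pair; rewrite -[RHS]scale1r -scalerDl addrC subrK.
- move=> s x y s01; have lGs := lG s (w, x) (w, y) s01.
  suff <- : s *: (w, x : R^o) + (1 - s) *: (w, y : R^o) = (w, s * x + (1 - s) * y) :> V * R^o.
    exact: lGs.
  by congr pair; rewrite -[RHS]scale1r -scalerDl addrC subrK.
- by apply: bounded_superlevels_gauss1 => s; have /andP[] := Gb v s.
- by apply: bounded_superlevels_gauss1 => s; have /andP[] := Gb w s.
- by move=> x y; exact: (lG t (v, x) (w, y) t01).
- by rewrite -intE; apply/esym; exact: fK.
- by rewrite -intE; apply/esym; exact: fK.
Qed.
End marginal.

(** * Reflections and Gaussian expectation *)

Section euclid.
Context {R : realType} {n : nat}.
Implicit Types x y a v : 'rV[R]_n.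

Lemma dotC x y : dot x y = dot y x.
Proof. by apply: eq_bigr => i _; rewrite mulrC. Qed.

Lemma dotDl x y a : dot (x + y) a = dot x a + dot y a.
Proof. by rewrite /dot -big_split; apply: eq_bigr => i _; rewrite mxE mulrDl. Qed.

Lemma dotZl k x a : dot (k *: x) a = k * dot x a.
Proof. by rewrite /dot mulr_sumr; apply: eq_bigr => i _; rewrite mxE mulrA. Qed.

Lemma dotNl x a : dot (- x) a = - dot x a.
Proof. by rewrite -scaleN1r dotZl mulN1r. Qed.

Lemma dotBl x y a : dot (x - y) a = dot x a - dot y a.
Proof. by rewrite dotDl dotNl. Qed.

Lemma dotZr k x a : dot a (k *: x) = k * dot a x.
Proof. by rewrite ![dot a _]dotC dotZl. Qed.

Lemma dotBr x y a : dot a (x - y) = dot a x - dot a y.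
Proof. by rewrite ![dot a _]dotC dotBl. Qed.

Lemma dotNr x a : dot a (- x) = - dot a x.
Proof. by rewrite ![dot a _]dotC dotNl. Qed.

Lemma dot_ge0 x : 0 <= dot x x.
Proof. by apply: sumr_ge0 => i _; rewrite -expr2 sqr_ge0. Qed.

Lemma dot_eq0 x : dot x x = 0 -> x = 0.
Proof.
move=> /eqP; rewrite psumr_eq0 => [/allP x0|i _]; last by rewrite -expr2 sqr_ge0.
apply/rowP => i; rewrite mxE; apply/eqP.
by have := x0 i (mem_index_enum _); rewrite -expr2 sqrf_eq0.
Qed.

Lemma enormK x : enorm x ^+ 2 = dot x x.
Proof. by rewrite /enorm sqr_sqrtr ?dot_ge0. Qed.

Lemma measurable_dot v : measurable_fun setT (fun x : 'rV[R]_n => dot x v).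
Proof.
apply: measurable_sum => i; apply: measurable_funM => //.
exact: measurable_coord_rV.
Qed.

(* For [a = 0] the division by zero yields 0 and this is the identity. *)
Definition householder a x := x - (2 * dot x a / dot a a) *: a.

Lemma householderD a : {morph householder a : x y / x + y}.
Proof.
move=> x y; rewrite /householder dotDl mulrDr mulrDl scalerDl opprD.
by rewrite addrACA.
Qed.

Lemma householderZ a k x : householder a (k *: x) = k *: householder a x.
Proof. by rewrite /householder dotZl scalerBr scalerA !mulrA [2 * k]mulrC. Qed.

Lemma dot_householder a x y : dot (householder a x) y = dot x (householder a y).
Proof.
rewrite /householder dotBl dotBr dotZl dotZr (dotC a y).
by congr (_ - _); rewrite -!mulrA; congr (2 * _); rewrite mulrCA [RHS]mulrCA [dot x a * _]mulrC.
Qed.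

Lemma householderK a : involutive (householder a).
Proof.
move=> x; have [a0|a0] := eqVneq (dot a a) 0.
  by rewrite /householder a0 invr0 !mulr0 !scale0r !subr0.
rewrite {1}/householder; set y := householder a x.
have -> : dot y a = - dot x a by rewrite dotBl dotZl divfK//; ring.
by rewrite mulrN mulNr scaleNr opprK /y /householder subrK.
Qed.

Lemma householder_isometry a x : dot (householder a x) (householder a x) = dot x x.
Proof. by rewrite dot_householder householderK. Qed.

Lemma measurable_householder a : measurable_fun setT (householder a).
Proof.
apply: measurable_fun_rV => i.
rewrite (_ : _ \o _ = fun x => coord_rV i x - 2 * dot x a / dot a a * a ord0 i); last first.
  by apply/funext => x; rewrite /coord_rV /householder /= !mxE.
apply: measurable_funB; first exact: measurable_coord_rV.
do 2 apply: measurable_funM => //; apply: measurable_funM => //.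
exact: measurable_dot.
Qed.

(** For vectors of equal length, [2 v . (v - w) = |v - w|^2], so the reflection subtracts exactly
    [v - w] from [v]. *)
Lemma householder_swap v w : dot v v = dot w w -> householder (v - w) v = w.
Proof.
move=> vw; rewrite /householder.
have [/dot_eq0 /eqP|a0] := eqVneq (dot (v - w) (v - w)) 0.
  by rewrite subr_eq0 => /eqP ->; rewrite subrr scaler0 subr0.
have E : 2 * dot v (v - w) = dot (v - w) (v - w).
  by rewrite !dotBl !dotBr -vw (dotC w v); ring.
by rewrite E divff// scale1r subKr.
Qed.

End euclid.

Section gaussian_expectation.
Context {R : realType} {n : nat}.
Local Notation lam := (@lebesgue_rV R).
Implicit Types (f g : 'rV[R]_n -> R) (A : set 'rV[R]_n).

Definition gexp f : R := fine (\int[lam n]_x (f x * gauss x)%:E).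

(** Such functions have finite Gaussian expectation, so [gexp] obeys real arithmetic on them. *)
Definition test_fun f := measurable_fun setT f /\ forall x, 0 <= f x <= 1.

Lemma test_fun_dominated f : test_fun f ->
  measurable_fun setT (fun x => f x * gauss x) /\
  forall x, 0 <= f x * gauss x <= 1 * gauss x.
Proof.
move=> [mf f01]; split=> [|x].
  by apply: measurable_funM => //; exact: measurable_gauss.
have g0 : 0 <= gauss x by rewrite ltW// gauss_gt0.
by have /andP[? ?] := f01 x; rewrite mulr_ge0// ler_wpM2r.
Qed.

Lemma gexpE f : test_fun f -> ((gexp f)%:E = \int[lam n]_x (f x * gauss x)%:E)%E.
Proof. by move=> /test_fun_dominated[mf fg]; exact: dominated_fineK mf ler01 fg. Qed.

Lemma gexp_ge0 f : test_fun f -> 0 <= gexp f.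
Proof.
by move=> /test_fun_dominated[mf fg]; have /andP[] := dominated_fine_bounds mf ler01 fg.
Qed.

Lemma le_gexp f g : test_fun f -> test_fun g -> (forall x, f x <= g x) ->
  gexp f <= gexp g.
Proof.
move=> tf tg fg; rewrite -lee_fin !gexpE//.
have [mf f0] := test_fun_dominated tf; have [mg _] := test_fun_dominated tg.
apply: ge0_le_integral => //.
- by move=> x _; rewrite lee_fin; have /andP[] := f0 x.
- exact/measurable_EFinP.
- exact/measurable_EFinP.
- by move=> x _; rewrite lee_fin ler_wpM2r// ltW// gauss_gt0.
Qed.

Lemma gexpD f g : test_fun f -> test_fun g -> test_fun (fun x => f x + g x) ->
  gexp (fun x => f x + g x) = gexp f + gexp g.
Proof.
move=> tf tg tfg; apply: EFin_inj; rewrite EFinD !gexpE//.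
have [mf f0] := test_fun_dominated tf; have [mg g0] := test_fun_dominated tg.
under eq_integral do rewrite mulrDl EFinD.
apply: ge0_integralD => //.
- by move=> x _; rewrite lee_fin; have /andP[] := f0 x.
- exact/measurable_EFinP.
- by move=> x _; rewrite lee_fin; have /andP[] := g0 x.
- exact/measurable_EFinP.
Qed.

Lemma gexpZ k f : 0 <= k <= 1 -> test_fun f -> gexp (fun x => k * f x) = k * gexp f.
Proof.
move=> /andP[k0 k1] tf; have [mf f0] := tf; have [mfg fg0] := test_fun_dominated tf.
apply: EFin_inj; rewrite EFinM !gexpE//.
  rewrite -ge0_integralZl//.
  - by apply: eq_integral => x _; rewrite -mulrA.
  - exact/measurable_EFinP.
  - by move=> x _; rewrite lee_fin; have /andP[] := fg0 x.
split; first exact: measurable_funM.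
by move=> x; have /andP[? ?] := f0 x; rewrite mulr_ge0// mulr_ile1.
Qed.

Lemma test_fun_cst1 : test_fun (cst 1).
Proof. by split=> // x; rewrite ler01 lexx. Qed.

Lemma gexp1 : gexp (cst 1) = 1.
Proof.
apply: EFin_inj; rewrite gexpE ?test_fun_cst1 -?[RHS](integral_gauss (R := R) n)//.
  by apply: eq_integral => x _; rewrite mul1r.
exact: test_fun_cst1.
Qed.

Lemma test_fun_indic A : measurable A -> test_fun (\1_A : _ -> R).
Proof.
move=> mA; split; first exact: measurable_indic.
by move=> x; rewrite indicE; case: (_ \in _); rewrite ?lexx ?ler01.
Qed.

Lemma test_funM f g : test_fun f -> test_fun g -> test_fun (fun x => f x * g x).
Proof.
move=> [mf f0] [mg g0]; split; first exact: measurable_funM.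
move=> x; have /andP[? ?] := f0 x; have /andP[? ?] := g0 x.
by rewrite mulr_ge0// mulr_ile1.
Qed.

Definition gprob A : R := gexp (\1_A).

Lemma gprobC A : measurable A -> gprob (~` A) = 1 - gprob A.
Proof.
move=> mA; have t1 := test_fun_indic mA; have t2 := test_fun_indic (measurableC mA).
have E : (fun x => \1_A x + \1_(~` A) x) = cst 1 :> (_ -> R).
  by apply/funext => x; rewrite !indicE in_setC; case: (_ \in _); rewrite ?addr0 ?add0r.
have <- : gprob A + gprob (~` A) = 1.
  rewrite /gprob -gexpD// ?E; first exact: gexp1.
  exact: test_fun_cst1.
by rewrite addrAC subrr add0r.
Qed.

Lemma gprob_ge0 A : measurable A -> 0 <= gprob A.
Proof. by move=> mA; exact/gexp_ge0/test_fun_indic. Qed.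

(** Chebyshev's association inequality for an indicator and a function separated by a threshold [c];
    no order on the space is involved. *)
Lemma gexp_chebyshev A f c : measurable A -> test_fun f -> 0 <= c <= 1 ->
  (forall x, A x -> c <= f x) -> (forall x, ~ A x -> f x <= c) ->
  gprob A * gexp f <= gexp (fun x => \1_A x * f x).
Proof.
move=> mA tf c01 Af Acf.
have tA := test_fun_indic mA; have tAc := test_fun_indic (measurableC mA).
have q1 := gprobC mA.
have p0 := gprob_ge0 mA; have q0 := gprob_ge0 (measurableC mA).
have tc g : test_fun g -> test_fun (fun x => c * g x).
  move=> tg; apply: (@test_funM (cst c)) => //; split=> //.
have cut : gexp f = gexp (fun x => \1_A x * f x) + gexp (fun x => \1_(~` A) x * f x).
  have E : (fun x => \1_A x * f x + \1_(~` A) x * f x) = f.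
    apply/funext => x; rewrite !indicE in_setC.
    by case: (_ \in _); rewrite ?(mul1r, mul0r, addr0, add0r).
  by rewrite -gexpD ?E//; exact: test_funM.
have a_ge : c * gprob A <= gexp (fun x => \1_A x * f x).
  rewrite -gexpZ//; apply: le_gexp => //; [exact: tc|exact: test_funM|].
  move=> x; rewrite indicE; have [/set_mem xA|] := boolP (x \in A).
    by rewrite mulr1 mul1r; exact: Af.
  by rewrite mulr0 mul0r.
have b_le : gexp (fun x => \1_(~` A) x * f x) <= c * gprob (~` A).
  rewrite -gexpZ//; apply: le_gexp => //; [exact: test_funM|exact: tc|].
  move=> x; rewrite indicE; have [/set_mem xA|] := boolP (x \in ~` A).
    by rewrite mulr1 mul1r; exact: Acf.
  by rewrite mulr0 mul0r.
(* With [p] the measure of [A], and [a], [b] the integrals of [f] over [A] and its complement,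
   [p b <= c p (1 - p) <= a (1 - p)], that is [p (a + b) <= a]. *)
rewrite cut; rewrite q1 in q0 b_le; nra.
Qed.

End gaussian_expectation.

(** * Symmetric convex sets and their slices *)

Section isometry.
Context {R : realType} {n : nat}.

Lemma gexp_isometry (f : 'rV[R]_n -> R) (T : 'rV[R]_n -> 'rV[R]_n) :
  test_fun f -> measurable_fun setT T -> involutive T ->
  {morph T : x y / x + y} -> (forall x, dot (T x) (T x) = dot x x) ->
  gexp (f \o T) = gexp f.
Proof.
move=> tf mT TK TD Tdot; have [mfg fg0] := test_fun_dominated tf.
rewrite /gexp; congr fine.
rewrite -(ge0_integral_rV_isometry (f := fun x => (f x * gauss x)%:E) _ _ mT TK TD Tdot).
- by apply: eq_integral => x _; rewrite /= !gaussE Tdot.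
- exact/measurable_EFinP.
- by move=> x; rewrite lee_fin; have /andP[] := fg0 x.
Qed.

Lemma gprob_householder a (A : set 'rV[R]_n) : measurable A ->
  gprob (householder a @^-1` A) = gprob A.
Proof.
move=> mA; rewrite /gprob -(gexp_isometry (f := \1_A) (T := householder a))//.
- exact: test_fun_indic.
- exact: measurable_householder.
- exact: householderK.
- exact: householderD.
- exact: householder_isometry.
Qed.

Lemma measurable_preimage_householder a (A : set 'rV[R]_n) : measurable A ->
  measurable (householder a @^-1` A).
Proof.
by move=> mA; rewrite -[X in measurable X]setTI; exact: measurable_householder.
Qed.

Lemma log_concave_gauss : log_concave (@gauss R n).
Proof.
move=> t x y t01; have /andP[t0 t1] := t01.
have c0 : 0 <= (Num.sqrt pi ^+ n)^-1 :> R by rewrite invr_ge0 exprn_ge0// sqrtr_ge0.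
rewrite !gaussE !powRM ?expR_ge0// mulrACA powR_onem//.
rewrite ler_wpM2r// -!expRM -expRD ler_expR /dot.
rewrite -!sumrN !mulr_suml -big_split /=; apply: ler_sum => i _.
rewrite !mxE; set a := x ord0 i; set b := y ord0 i.
have t1' : 0 <= 1 - t by rewrite subr_ge0 ltW.
(* Convexity of the square in each coordinate; the gap is [t (1 - t) (a - b)^2]. *)
by have := mulr_ge0 (mulr_ge0 (ltW t0) t1') (sqr_ge0 (a - b)); rewrite expr2; lra.
Qed.

End isometry.

Definition sym_convex (R : realType) n (K : set 'rV[R]_n) :=
  [/\ measurable K, (forall x, K x -> K (- x)) &
      forall t x y, 0 < t < 1 -> K x -> K y -> K (t *: x + (1 - t) *: y)].

Definition slab (R : realType) n (v : 'rV[R]_n) (c : R) : set 'rV[R]_n :=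
  [set x | `|dot x v| <= c].

Section slab.
Context {R : realType} {n : nat}.
Implicit Types (v : 'rV[R]_n) (c : R).

Lemma sym_convex_slab v c : sym_convex (slab v c).
Proof.
split.
- have : measurable_fun setT (fun x : 'rV[R]_n => `|dot x v| <= c).
    apply: measurable_fun_ler => //.
    by apply: measurableT_comp => //; exact: measurable_dot.
  by move=> /(_ measurableT [set true]); rewrite setTI; exact.
- by move=> x; rewrite /slab /= dotNl normrN.
- move=> t x y /andP[t0 t1]; rewrite /slab /= dotDl !dotZl => xc yc.
  apply: le_trans (ler_normD _ _) _; rewrite !normrM (gtr0_norm t0).
  have t1' : 0 < 1 - t by rewrite subr_gt0.
  rewrite (gtr0_norm t1').
  by have := ler_wpM2l (ltW t0) xc; have := ler_wpM2l (ltW t1') yc; lra.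
Qed.

Lemma sym_convexT : sym_convex [set: 'rV[R]_n].
Proof. by split. Qed.

Lemma sym_convexI (A B : set 'rV[R]_n) :
  sym_convex A -> sym_convex B -> sym_convex (A `&` B).
Proof.
move=> [mA sA cA] [mB sB cB]; split.
- exact: measurableI.
- by move=> x [/sA ? /sB ?].
- by move=> t x y t01 [Ax Bx] [Ay By]; split; [exact: cA|exact: cB].
Qed.

Lemma sym_convex_householder a (A : set 'rV[R]_n) :
  sym_convex A -> sym_convex (householder a @^-1` A).
Proof.
move=> [mA sA cA]; split.
- exact: measurable_preimage_householder.
- by move=> x /= /sA; rewrite -scaleN1r -householderZ scaleN1r.
- by move=> t x y t01 /= Ax Ay; rewrite householderD !householderZ; exact: cA.
Qed.

Lemma preimage_householder_slab a v c :
  householder a @^-1` slab v c = slab (householder a v) c.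
Proof. by apply/seteqP; split => x; rewrite /slab /= dot_householder. Qed.

End slab.

Section slices.
Context {R : realType} {n : nat}.
Implicit Types K : set 'rV[R]_n.+1.
Local Notation lam := (@lebesgue_rV R).

Definition slice K (t : R) : R := gexp (fun y : 'rV[R]_n => \1_K (cons_rV (t, y))).

Lemma measurable_cons_rVr (t : R) :
  measurable_fun setT (fun y : 'rV[R]_n => cons_rV (t, y)).
Proof.
apply: (measurableT_comp (@measurable_cons_rV R n)).
by apply: measurable_fun_pair => //; exact: measurable_cst.
Qed.

Lemma test_fun_slice K t : measurable K ->
  test_fun (fun y : 'rV[R]_n => \1_K (cons_rV (t, y)) : R).
Proof.
move=> /test_fun_indic[mK K01]; split=> [|y]; last exact: K01.
exact: (measurableT_comp mK (measurable_cons_rVr t)).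
Qed.

Lemma slice_bounds K t : measurable K -> 0 <= slice K t <= 1.
Proof.
move=> mK; have [mf fg] := test_fun_dominated (test_fun_slice t mK).
exact: dominated_fine_bounds mf ler01 fg.
Qed.

Lemma measurable_slice K : measurable K ->
  measurable_fun setT (slice K : measurableTypeR R -> R).
Proof.
move=> mK; have [mI I01] := test_fun_indic (R := R) mK.
apply/measurable_EFinP.
rewrite (_ : _ \o _ =
    fun t => \int[lam n]_y (\1_K (cons_rV (t, y)) * gauss y)%:E)%E; last first.
  by apply/funext => t; exact: gexpE (test_fun_slice t mK).
apply: (measurable_fun_fubini_tonelli_F (fun p => (\1_K (cons_rV p) * gauss p.2)%:E)).
  apply/measurable_EFinP; apply: measurable_funM.
    by apply: (measurableT_comp mI); exact: measurable_cons_rV.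
  by apply: (measurableT_comp (@measurable_gauss R n)).
by move=> p; rewrite lee_fin mulr_ge0// ltW// gauss_gt0.
Qed.

(** Replaces the indicator of [K] by its conditional expectation given the first coordinate. The
    result is still a function on the whole space, as the association inequality requires. *)
Lemma gexp_slice K (phi : R -> R) : measurable K ->
  measurable_fun setT (phi : measurableTypeR R -> R) -> (forall t, 0 <= phi t <= 1) ->
  let f (x : 'rV[R]_n.+1) := slice K (coord_rV ord0 x) * phi (coord_rV ord0 x) in
  test_fun f /\
  gexp (fun x : 'rV[R]_n.+1 => \1_K x * phi (coord_rV ord0 x)) = gexp f.
Proof.
move=> mK mphi phi01 f.
have mc : measurable_fun setT (@coord_rV R n.+1 ord0 : _ -> measurableTypeR R).
  exact: measurable_coord_rV.
have tphi : test_fun (fun x : 'rV[R]_n.+1 => phi (coord_rV ord0 x)).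
  by split=> [|x]; [exact: (measurableT_comp mphi mc)|exact: phi01].
have tsl : test_fun (fun x : 'rV[R]_n.+1 => slice K (coord_rV ord0 x)).
  split=> [|x]; last exact: slice_bounds.
  exact: (measurableT_comp (measurable_slice mK) mc).
have tf : test_fun f by exact: test_funM.
have tK := test_funM (test_fun_indic mK) tphi.
split=> //; apply: EFin_inj; rewrite !gexpE//.
have [mfg fg0] := test_fun_dominated tf; have [mKg Kg0] := test_fun_dominated tK.
rewrite !ge0_integral_cons_rV; last 4 first.
- exact/measurable_EFinP.
- by move=> x; rewrite lee_fin; have /andP[] := fg0 x.
- exact/measurable_EFinP.
- by move=> x; rewrite lee_fin; have /andP[] := Kg0 x.
apply: eq_integral => s _.
have c0 : 0 <= phi s * gauss1 s.
  by have /andP[? _] := phi01 s; rewrite mulr_ge0// ltW// gauss1_gt0.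
have sl0 : 0 <= slice K s by have /andP[] := slice_bounds s mK.
transitivity ((phi s * gauss1 s)%:E * (slice K s)%:E)%E.
  rewrite (gexpE (test_fun_slice s mK)).
  have [ms s0] := test_fun_dominated (test_fun_slice s mK).
  rewrite -ge0_integralZl//; last 2 first.
  - exact/measurable_EFinP.
  - by move=> y _; rewrite lee_fin; have /andP[] := s0 y.
  apply: eq_integral => y _.
  by rewrite coord_cons_rV0 gauss_cons_rV -EFinM; congr EFin; rewrite /=; ring.
(* On the other side the integrand depends on [y] only through [gauss y], whose integral is 1. *)
rewrite -[LHS]mule1 -(integral_gauss (R := R) n) -EFinM -ge0_integralZl//; last 3 first.
- by apply/measurable_EFinP; exact: measurable_gauss.
- by move=> y _; rewrite lee_fin ltW// gauss_gt0.
- by rewrite lee_fin mulr_ge0.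
apply: eq_integral => y _.
by rewrite /f coord_cons_rV0 gauss_cons_rV -EFinM; congr EFin; rewrite /=; ring.
Qed.

Lemma cons_rVN (t : R) (y : 'rV[R]_n) : - cons_rV (t, y) = cons_rV (- t, - y).
Proof. by rewrite -scaleN1r cons_rVZ /= mulN1r scaleN1r. Qed.

(** The map [y -> - y] preserves the Gaussian measure and exchanges the slices at heights [t] and
    [- t]. *)
Lemma sliceN K t : sym_convex K -> slice K (- t) = slice K t.
Proof.
move=> [mK sK _]; rewrite /slice.
rewrite -(gexp_isometry (T := -%R) (test_fun_slice t mK)).
- congr gexp; apply/funext => y /=; rewrite !indicE.
  rewrite (_ : cons_rV (t, - y) = - cons_rV (- t, y)); last by rewrite cons_rVN opprK.
  congr ((nat_of_bool _)%:R); apply/idP/idP => /set_mem Kx; apply/mem_set; first exact: sK.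
  by rewrite -[cons_rV _]opprK; exact: sK.
- by apply: measurable_fun_oppr_rV.
- exact: opprK.
- exact: opprD.
- by move=> x; rewrite dotNl dotNr opprK.
Qed.

(** The indicator of a convex set times the Gaussian density is jointly log-concave in height and
    position, so its marginal is log-concave in the height. *)
Lemma log_concave_slice K : sym_convex K -> @log_concave R R^o (slice K).
Proof.
move=> [mK _ cK].
apply: (marginal_log_concave (V := R^o)
  (f := fun t (y : 'rV[R]_n) => \1_K (cons_rV (t : R, y)) * gauss y)).
- by move=> t; have [] := test_fun_dominated (test_fun_slice t mK).
- by move=> t y; have [_ /(_ y)] := test_fun_dominated (test_fun_slice t mK); rewrite mul1r.
- move=> t [s y] [s' y'] t01 /=; have /andP[t0 t1] := t01.
  have g0 z : 0 <= @gauss R n z by rewrite ltW// gauss_gt0.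
  rewrite !indicE.
  have [/set_mem K1|_] := boolP (cons_rV (s, y) \in K); last first.
    by rewrite mul0r powR0 ?gt_eqF// mul0r mulr_ge0.
  have [/set_mem K2|_] := boolP (cons_rV (s', y') \in K); last first.
    by rewrite mul0r [X in _ * X]powR0 ?mulr0 ?mulr_ge0// gt_eqF// subr_gt0.
  rewrite mem_set ?mul1r; first exact: log_concave_gauss.
  by have := cK t _ _ t01 K1 K2; rewrite !cons_rVZ cons_rVD.
Qed.

(** An even log-concave function decreases away from 0: [|s|] lies between [- |t|] and [|t|], where
    the slices have equal measure. *)
Lemma slice_anderson K s t : sym_convex K -> `|s| <= `|t| -> slice K t <= slice K s.
Proof.
move=> sK st.
have abs u : slice K u = slice K `|u|.
  by have [u0|u0] := leP 0 u; rewrite ?(ger0_norm u0)// ltr0_norm// sliceN.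
rewrite (abs s) (abs t).
move: st; rewrite le_eqVlt => /orP[/eqP -> //|st].
have t0 : 0 < `|t| by apply: le_lt_trans st.
(* The weight for which [`|s| = l * `|t| + (1 - l) * - `|t|]. *)
pose l := (`|s| + `|t|) / (2 * `|t|).
have l01 : 0 < l < 1.
  rewrite /l divr_gt0/= ?ltr_pdivrMr ?mulr_gt0 ?ltr_wpDl//; lra.
have mK : measurable K by case: sK.
have /andP[sl0 _] := slice_bounds `|t| mK.
have := log_concave_slice sK `|t| (- `|t|) l01.
rewrite sliceN// powR_onem//; congr (_ <= slice K _).
rewrite /GRing.scale /=.
have : l * (2 * `|t|) = `|s| + `|t| by rewrite /l divfK// mulf_neq0 ?gt_eqF.
lra.
Qed.

End slices.

(** * Sidak's inequality *)

Section sidak.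
Context {R : realType} {n : nat}.
Implicit Types (v : 'rV[R]_n.+1) (K : set 'rV[R]_n.+1) (c r : R).

Definition axis : 'rV[R]_n.+1 := delta_mx ord0 ord0.

Lemma dot_axis (x : 'rV[R]_n.+1) : dot x axis = coord_rV ord0 x.
Proof.
rewrite /dot (bigD1 ord0)//= big1 => [|i i0].
  by rewrite mxE !eqxx mulr1 addr0.
by rewrite mxE eqxx (negPf i0) mulr0.
Qed.

(** Normal vector of the reflection carrying [v] to the nonnegative first axis; it is 0, and the
    reflection the identity, when [v] is already there. *)
Definition to_axis v := v - enorm v *: axis.

Lemma householder_to_axis v : householder (to_axis v) v = enorm v *: axis.
Proof.
apply: householder_swap; rewrite dotZl dotZr dot_axis /coord_rV mxE !eqxx mulr1.
by rewrite -enormK expr2.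
Qed.

Lemma slab_axis r c :
  slab (r *: axis) c = [set x | `|r * coord_rV ord0 x| <= c].
Proof. by apply/seteqP; split=> x; rewrite /slab /= dotZr dot_axis. Qed.

Lemma slab_lt0 v c : c < 0 -> slab v c = set0.
Proof.
move=> c0; apply/seteqP; split=> x //.
by rewrite /slab /= leNgt (lt_le_trans c0 (normr_ge0 _)).
Qed.

Lemma measurable_slab v c : measurable (slab v c).
Proof. by have [] := sym_convex_slab v c. Qed.

Lemma gprob_slab_axis v c : gprob (slab v c) = gprob (slab (enorm v *: axis) c).
Proof.
rewrite -(gprob_householder (to_axis v)); last exact: measurable_slab.
by rewrite preimage_householder_slab householder_to_axis.
Qed.

Lemma gprob_slabI_axis v c K : measurable K ->
  gprob (slab v c `&` K) =
  gprob (slab (enorm v *: axis) c `&` householder (to_axis v) @^-1` K).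
Proof.
move=> mK; rewrite -(gprob_householder (to_axis v)); last first.
  by apply: measurableI => //; exact: measurable_slab.
by rewrite preimage_setI preimage_householder_slab householder_to_axis.
Qed.

Let strip r c (t : R) : R := (`|r * t| <= c)%R%:R.

Let measurable_strip r c : measurable_fun setT (strip r c : measurableTypeR R -> R).
Proof.
rewrite (_ : strip r c = \1_[set t : measurableTypeR R | `|r * t| <= c]); last first.
  apply/funext => t; rewrite indicE; congr ((nat_of_bool _)%:R).
  by apply/idP/idP => [rt|/set_mem //]; rewrite mem_set.
apply: measurable_indic.
have : measurable_fun setT (fun t : measurableTypeR R => `|r * t| <= c).
  apply: measurable_fun_ler => //.
  by apply: measurableT_comp => //; exact: measurable_funM.
by move=> /(_ measurableT [set true]); rewrite setTI; exact.
Qed.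

Let strip01 r c t : 0 <= strip r c t <= 1.
Proof. by rewrite /strip; case: (`|_| <= _)%R; rewrite /= ?lexx ?ler01. Qed.

Let indic_slab_axis r c (x : 'rV[R]_n.+1) :
  \1_(slab (r *: axis) c) x = strip r c (coord_rV ord0 x).
Proof.
rewrite slab_axis indicE /strip; congr ((nat_of_bool _)%:R).
by apply/idP/idP => [/set_mem //|rt]; rewrite mem_set.
Qed.

Lemma gprob_slab_axisI r c K : measurable K ->
  gprob (slab (r *: axis) c `&` K) =
  gexp (fun x => \1_(slab (r *: axis) c) x * slice K (coord_rV ord0 x)).
Proof.
move=> mK; have [_] := gexp_slice mK (measurable_strip r c) (strip01 r c).
move=> E; transitivity (gexp (fun x => \1_K x * strip r c (coord_rV ord0 x))).
  by congr gexp; apply/funext => x; rewrite indicI mulrC /= indic_slab_axis.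
by rewrite E; congr gexp; apply/funext => x; rewrite indic_slab_axis mulrC.
Qed.

Lemma gprob_slice K : measurable K ->
  test_fun (fun x : 'rV[R]_n.+1 => slice K (coord_rV ord0 x)) /\
  gprob K = gexp (fun x : 'rV[R]_n.+1 => slice K (coord_rV ord0 x)).
Proof.
move=> mK; have c01 (t : R) : 0 <= (1 : R) <= 1 by rewrite ler01 lexx.
have [] := gexp_slice mK (measurable_cst (1 : R)) c01.
have -> : (fun x : 'rV[R]_n.+1 => slice K (coord_rV ord0 x) * cst 1 (coord_rV ord0 x)) =
    (fun x : 'rV[R]_n.+1 => slice K (coord_rV ord0 x)) by apply/funext => x; rewrite mulr1.
move=> ? <-; split=> //.
by congr gexp; apply/funext => x; rewrite mulr1.
Qed.

(** After the reflection the slab bounds the first coordinate by [c / r], and the slice measure at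
    that height is the threshold separating its values inside and outside the slab. *)
Lemma gprob_slab_le v c K : sym_convex K ->
  gprob (slab v c) * gprob K <= gprob (slab v c `&` K).
Proof.
move=> sK; have mK : measurable K by case: sK.
rewrite gprob_slab_axis (gprob_slabI_axis _ _ mK).
rewrite -(gprob_householder (to_axis v) mK).
have {sK} := sym_convex_householder (to_axis v) sK.
move: (_ @^-1` _) => {mK}K sK; have mK : measurable K by case: sK.
set r := enorm v; have r0 : 0 <= r by exact: sqrtr_ge0.
rewrite (gprob_slab_axisI _ _ mK); have [tK ->] := gprob_slice mK.
(* Two degenerate cases. For [c < 0] the slab is empty and the threshold 1 works; for [r = 0 <= c]
   it is the whole space and the threshold 0 works. *)
have [c0|c0] := ltP c 0.
  apply: (gexp_chebyshev (c := 1)) => //; rewrite ?lexx ?ler01//.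
  - exact: measurable_slab.
  - by rewrite slab_lt0.
  - by move=> x _; have /andP[] := slice_bounds (coord_rV ord0 x) mK.
have := r0; rewrite le_eqVlt => /orP[/eqP r_0|r_gt0].
  apply: (gexp_chebyshev (c := 0)) => //; rewrite ?lexx ?ler01//.
  - exact: measurable_slab.
  - by move=> x _; have /andP[] := slice_bounds (coord_rV ord0 x) mK.
  - by move=> x; rewrite slab_axis /= -r_0 mul0r normr0 c0.
have cr : 0 <= c / r by rewrite divr_ge0.
apply: (gexp_chebyshev (c := slice K (c / r))) => //.
- exact: measurable_slab.
- exact: slice_bounds.
- move=> x; rewrite slab_axis /= normrM (ger0_norm r0) => xc.
  by apply: slice_anderson => //; rewrite (ger0_norm cr) ler_pdivlMr// mulrC.
- move=> x; rewrite slab_axis /= normrM (ger0_norm r0) => /negP; rewrite -ltNge => xc.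
  by apply: slice_anderson => //; rewrite (ger0_norm cr) ler_pdivrMr// mulrC ltW.
Qed.

(** Invariance along [v] makes all slices orthogonal to [v] equally large, so the slice measure
    factors out of the integral over the slab. *)
Lemma gprob_slab_indep v c K : measurable K ->
  (forall x k, K x -> K (x + k *: v)) ->
  gprob (slab v c `&` K) = gprob (slab v c) * gprob K.
Proof.
move=> mK Kv.
(* A zero [v] determines no direction, but its slab is empty or the whole space. *)
have [v0|v0] := eqVneq v 0.
  have [c0|c0] := ltP c 0.
    rewrite (slab_lt0 v c0) set0I /gprob indic0.
    rewrite (_ : gexp _ = 0) ?mul0r// /gexp.
    by rewrite integral0_eq// => x _; rewrite mul0r.
  have -> : slab v c = setT.
    apply/seteqP; split=> x //= _; rewrite /slab /= v0.
    by rewrite -(scale0r (0 : 'rV[R]_n.+1)) dotZr mul0r normr0.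
  by rewrite setTI /gprob indicT gexp1 mul1r.
rewrite gprob_slab_axis (gprob_slabI_axis _ _ mK) -(gprob_householder (to_axis v) mK).
have r0 : enorm v != 0.
  by apply: contra v0 => /eqP r0; apply/eqP/dot_eq0; rewrite -enormK r0 expr0n.
(* The reflection is an involution, so it sends the axis to [v / |v|]; invariance along [v] thus
   becomes invariance along the axis. *)
have {Kv} : forall x k, (householder (to_axis v) @^-1` K) x ->
    (householder (to_axis v) @^-1` K) (x + k *: axis).
  move=> x k /= Kx; rewrite householderD householderZ.
  have -> : householder (to_axis v) axis = (enorm v)^-1 *: v.
    apply: (scalerI r0); rewrite scalerA mulfV// scale1r -householderZ.
    by rewrite -householder_to_axis householderK.
  by rewrite scalerA; exact: Kv.
have {mK} := measurable_preimage_householder (to_axis v) mK.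
move: (_ @^-1` _) => {}K mK Ka.
rewrite (gprob_slab_axisI _ _ mK); have [tK ->] := gprob_slice mK.
have slc t : slice K t = slice K 0.
  rewrite /slice; congr gexp; apply/funext => y; rewrite !indicE.
  have E s s' : cons_rV (s, y) + (s' - s) *: axis = cons_rV (s', y).
    apply/rowP => i; rewrite mxE [X in _ + X]mxE [X in _ + _ * X]mxE -!/(coord_rV _ _).
    have [j ->|->] := unliftP ord0 i.
      by rewrite !coord_cons_rVS/= mulr0 addr0.
    by rewrite !coord_cons_rV0/= mulr1 addrC subrK.
  congr ((nat_of_bool _)%:R); apply/idP/idP => /set_mem Kx; apply/mem_set.
    by rewrite -(E t 0); exact: Ka.
  by rewrite -(E 0 t); exact: Ka.
have s01 := slice_bounds 0 mK.
have E1 : gexp (fun x : 'rV[R]_n.+1 => slice K (coord_rV ord0 x)) = slice K 0.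
  rewrite -[RHS]mulr1 -(gexp1 (R := R) (n := n.+1)) -gexpZ//; last exact: test_fun_cst1.
  by congr gexp; apply/funext => x; rewrite mulr1 slc.
rewrite E1 mulrC -gexpZ//; last by apply: test_fun_indic; exact: measurable_slab.
by congr gexp; apply/funext => x; rewrite slc mulrC.
Qed.

End sidak.

(** * Finite intersections of slabs *)

Section family.
Context {R : realType} {n : nat} {I : eqType}.
Implicit Types (u : I -> 'rV[R]_n.+1) (c : I -> R) (s : seq I).

Definition slabs u c s : set 'rV[R]_n.+1 :=
  [set x | forall i, i \in s -> slab (u i) (c i) x].

Lemma slabs_nil u c : slabs u c [::] = setT.
Proof. by apply/seteqP; split. Qed.

Lemma slabs_cons u c i s : slabs u c (i :: s) = slab (u i) (c i) `&` slabs u c s.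
Proof.
apply/seteqP; split=> x /=.
  move=> H; split; first by apply: H; rewrite mem_head.
  by move=> j js; apply: H; rewrite inE js orbT.
by move=> [Hi Hs] j; rewrite inE => /orP[/eqP ->//|]; exact: Hs.
Qed.

Lemma sym_convex_slabs u c s : sym_convex (slabs u c s).
Proof.
elim: s => [|i s IH]; first by rewrite slabs_nil; exact: sym_convexT.
by rewrite slabs_cons; apply: sym_convexI => //; exact: sym_convex_slab.
Qed.

Lemma gprob_setT : gprob [set: 'rV[R]_n.+1] = 1.
Proof. by rewrite /gprob indicT gexp1. Qed.

Lemma sidak u c s :
  \prod_(i <- s) gprob (slab (u i) (c i)) <= gprob (slabs u c s).
Proof.
elim: s => [|i s IH]; first by rewrite big_nil slabs_nil gprob_setT.
rewrite big_cons slabs_cons; apply: le_trans (gprob_slab_le _ _ (sym_convex_slabs u c s)).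
by rewrite ler_wpM2l// gprob_ge0//; exact: measurable_slab.
Qed.

(** The slabs of the remaining vectors are invariant along [u i] by orthogonality; [uniq s] ensures
    that [i] does not recur among them. *)
Lemma gprob_slabs_orthogonal u c s : uniq s ->
  (forall i j, i != j -> dot (u i) (u j) = 0) ->
  gprob (slabs u c s) = \prod_(i <- s) gprob (slab (u i) (c i)).
Proof.
move=> us ort; elim: s us => [_|i s IH /= /andP[iNs us]].
  by rewrite big_nil slabs_nil gprob_setT.
rewrite big_cons slabs_cons -IH//; apply: gprob_slab_indep.
  by have [] := sym_convex_slabs u c s.
move=> x k Kx j js; rewrite /slab /= dotDl dotZl ort ?mulr0 ?addr0; first exact: Kx.
by apply: contraNneq iNs => ->.
Qed.

(** Sidak's inequality for [v] against equality for [w]; the factors agree because each slab can be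
    reflected onto the first axis. *)
Lemma gprob_slabs_le (v w : I -> 'rV[R]_n.+1) c s : uniq s ->
  (forall i, enorm (v i) = enorm (w i)) ->
  (forall i j, i != j -> dot (w i) (w j) = 0) ->
  gprob (slabs w c s) <= gprob (slabs v c s).
Proof.
move=> us vw ort; rewrite gprob_slabs_orthogonal//; apply: le_trans (sidak _ _ _).
apply: ler_prod => i _; rewrite (gprob_ge0 (measurable_slab (w i) (c i))) /=.
by rewrite [leRHS]gprob_slab_axis vw -gprob_slab_axis.
Qed.

End family.

(** * Layers of the integrand *)

Section max_exponential.
Context {R : realType} {n N : nat}.
Implicit Types (u : 'I_N -> 'rV[R]_n) (x : 'rV[R]_n).

Definition max_exp u x : R :=
  \big[Num.max/0]_(i < N) expR (2 * `|dot x (u i)| - enorm (u i) ^+ 2).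

Lemma with_opp_maxE u x :
  \big[Num.max/0]_(z <- with_opp u) expR (- enorm (x - z) ^+ 2) =
  expR (- dot x x) * max_exp u x.
Proof.
rewrite /max_exp /with_opp -big_enum /=.
elim: (enum 'I_N) => [|i s IH]; first by rewrite !big_nil mulr0.
rewrite /= !big_cons IH maxr_pMr ?expR_ge0// maxA; congr Num.max.
have E (z : 'rV[R]_n) : enorm z = enorm (u i) ->
    expR (- enorm (x - z) ^+ 2) = expR (- dot x x) * expR (2 * dot x z - enorm (u i) ^+ 2).
  move=> zi; rewrite -expRD; congr expR; rewrite -zi !enormK dotBl !dotBr (dotC z x).
  ring.
rewrite !E//; last by rewrite /enorm dotNl dotNr opprK.
rewrite -maxr_pMr ?expR_ge0//; congr (_ * _); rewrite dotNr mulrN.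
have [d0|d0] := leP 0 (dot x (u i)).
  by rewrite (ger0_norm d0); rewrite max_l ?ler_expR //; lra.
by rewrite (ltr0_norm d0); rewrite mulrN max_r ?ler_expR //; lra.
Qed.

Lemma max_exp_ge0 u x : 0 <= max_exp u x.
Proof. exact: bigmax_ge_id. Qed.

Lemma measurable_max_exp u : measurable_fun setT (max_exp u).
Proof.
rewrite /max_exp; elim: (index_enum _) => [|i s IH].
  under eq_fun do rewrite big_nil; exact: measurable_cst.
under eq_fun do rewrite big_cons.
apply: measurable_maxr => //; apply: measurableT_comp => //.
apply: measurable_funB => //; apply: measurable_funM => //.
by apply: measurableT_comp => //; exact: measurable_dot.
Qed.

(** Taking logarithms turns the bound into slab conditions; [0 < t] also covers the default value 0
    of the maximum. *)
Lemma max_exp_le u x t : 0 < t ->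
  (max_exp u x <= t) =
  [forall i, `|dot x (u i)| <= (ln t + enorm (u i) ^+ 2) / 2].
Proof.
move=> t0; apply/bigmax_leP/forallP => [[_ H] i|H].
  have := H i isT; rewrite -[leRHS](lnK t0) ler_expR ler_pdivlMr//; lra.
split=> [|i _]; first exact: ltW.
have := H i; rewrite -[X in _ -> _ <= X](lnK t0) ler_expR ler_pdivlMr//; lra.
Qed.

End max_exponential.

Section layers.
Context {R : realType} {n N : nat}.
Local Notation lam := (@lebesgue_rV R).
Implicit Types (u : 'I_N -> 'rV[R]_n.+1) (t : R).

Definition level u t := slabs u (fun i => (ln t + enorm (u i) ^+ 2) / 2) (enum 'I_N).

Lemma layerE u t : 0 < t ->
  (\int[lam n.+1]_x (if (0 < t < max_exp u x)%R then (gauss x)%:E else 0) =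
   (1 - gprob (level u t))%:E)%E.
Proof.
move=> t0; have mL : measurable (level u t) by have [] := sym_convex_slabs u
  (fun i => (ln t + enorm (u i) ^+ 2) / 2) (enum 'I_N).
rewrite -gprobC// gexpE; last by apply: test_fun_indic; exact: measurableC.
apply: eq_integral => x _; rewrite t0 ltNge max_exp_le//= indicE in_setC.
have -> : (x \in level u t) = [forall i, `|dot x (u i)| <= (ln t + enorm (u i) ^+ 2) / 2].
  apply/idP/forallP => [/set_mem + i|H]; first by apply; rewrite mem_enum.
  by rewrite mem_set// => i _; exact: H.
by case: [forall _, _]; rewrite /= ?mul0r ?mul1r.
Qed.

(** The factor [e^(-|x|^2)] is absorbed into the weight of the layer-cake formula; the constant
    undoes its normalization. *)
Lemma P_with_oppE u :
  (P (with_opp u) = (Num.sqrt pi ^+ n.+1)%:E *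
    \int[lebesgue_measure]_t \int[lam n.+1]_x
      (if (0 < t < max_exp u x)%R then (gauss x)%:E else 0))%E.
Proof.
have mg : measurable_fun setT (fun x : 'rV[R]_n.+1 => (gauss x)%:E).
  by apply/measurable_EFinP; exact: measurable_gauss.
have g0 x : (0 <= (@gauss R n.+1 x)%:E)%E by rewrite lee_fin ltW// gauss_gt0.
have c0 : 0 < Num.sqrt pi ^+ n.+1 :> R by rewrite exprn_gt0// sqrtr_gt0 pi_gt0.
rewrite -(ge0_integral_layer_cake _ (measurable_max_exp u) (max_exp_ge0 u) mg g0).
rewrite -ge0_integralZl//; last 2 first.
- by apply: emeasurable_funM => //; apply/measurable_EFinP; exact: measurable_max_exp.
- by move=> x _; rewrite mule_ge0// lee_fin max_exp_ge0.
apply: eq_integral => x _; rewrite with_opp_maxE -!EFinM gaussE; congr EFin.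
by field; rewrite gt_eqF.
Qed.

End layers.

Theorem theorem3p2 (R : realType) (n N : nat) (N_ge1 : (1 <= N)%N)
    (N_le_n : (N <= n)%N) (r : 'I_N -> R) (r_ge0 : forall i, 0 <= r i)
    (v w : 'I_N -> 'rV[R]_n)
    (norm_v : forall i, enorm (v i) = r i)
    (norm_w : forall i, enorm (w i) = r i)
    (orth_w : forall i j, i != j -> dot (w i) (w j) = 0) :
  (P (with_opp v) <= P (with_opp w))%E.
Proof.
(* Slicing needs a first coordinate; dimension 0 is excluded by [1 <= N <= n]. *)
case: n N_le_n v w norm_v norm_w orth_w => [|n] N_le_n v w norm_v norm_w orth_w.
  by have := leq_trans N_ge1 N_le_n.
have mg : measurable_fun setT (fun x : 'rV[R]_n.+1 => (gauss x)%:E).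
  by apply/measurable_EFinP; exact: measurable_gauss.
have g0 x : (0 <= (@gauss R n.+1 x)%:E)%E by rewrite lee_fin ltW// gauss_gt0.
rewrite !P_with_oppE; apply: lee_wpmul2l.
  by rewrite lee_fin exprn_ge0// sqrtr_ge0.
apply: ge0_le_integral => //.
- by move=> t _; apply: integral_ge0 => x _; case: ifP.
- exact: measurable_layer (measurable_max_exp v) mg g0.
- exact: measurable_layer (measurable_max_exp w) mg g0.
(* Layers at [t <= 0] vanish on both sides, so [ln t] is only used for positive [t]. *)
move=> t _; have /orP[t0|t0] : (t <= 0) || (0 < t) by rewrite leNgt orNb.
  by rewrite !integral0_eq// => x _; rewrite ltNge t0.
rewrite (layerE v t0) (layerE w t0) lee_fin lerD2l lerN2 /level.
(* Equal norms give both families the same slab widths, as the comparison of intersections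
   requires. *)
have -> : (fun i => (ln t + enorm (v i) ^+ 2) / 2) = (fun i => (ln t + enorm (w i) ^+ 2) / 2).
  by apply/funext => i; rewrite norm_v norm_w.
by apply: gprob_slabs_le => [|i|//]; [exact: enum_uniq|rewrite norm_v].
Qed.
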